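(* Let $$\Sigma:=\{(x,y)\in\mathbb{R}^2\setminus B_1:\ x>0\ \text{and}\ y>0\}.$$ For $s\in(0,1/2)$ let $E_s$ be the minimizer of $\mathrm{Per}_s(E,B_1)$ among all the sets $E\subseteq\mathbb{R}^2$ such that $E\setminus B_1=\Sigma$. Then there exists $s_o>0$ such that for any $s\in(0,s_o]$ we have $E_s=\Sigma$.
   Context: $B_1$ is the unit ball of $\mathbb{R}^2$ centered at the origin. For $s\in(0,1/2)$, an open set $\Omega\subseteq\mathbb{R}^n$ (here $n=2$) and $E\subseteq\mathbb{R}^n$, with $E^c:=\mathbb{R}^n\setminus E$, the $s$-perimeter of $E$ in $\Omega$ is $$\mathrm{Per}_s(E,\Omega):=L(E\cap\Omega,E^c)+L(\Omega\setminus E,E\setminus\Omega),\qquad L(F,G):=\iint_{F\times G}\frac{dx\,dy}{|x-y|^{n+2s}}$$ for disjoint sets $F,G$. Sets are measurable and, as usual for minimizers, are understood up to sets of Lebesgue measure zero. *)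

(* Defs.v *)
From HB Require Import structures.
From mathcomp Require Import all_boot all_order all_algebra.
From mathcomp Require Import all_classical all_reals all_analysis.

Set Implicit Arguments.
Unset Strict Implicit.
Unset Printing Implicit Defensive.
Import Order.TTheory GRing.Theory Num.Theory.
Local Open Scope classical_set_scope.
Local Open Scope ring_scope.

Notation plane R := (measurableTypeR R * measurableTypeR R)%type.

Notation leb2 R := ((@lebesgue_measure R) \x (@lebesgue_measure R))%E.

(* The library norm on a product type is the sup norm, hence this definition. *)
Definition eucl_norm (R : realType) (x : plane R) : R :=
  Num.sqrt (x.1 ^+ 2 + x.2 ^+ 2).

Definition eucl_dist (R : realType) (x y : plane R) : R :=
  eucl_norm (x.1 - y.1, x.2 - y.2).

(* The double integral is written as an iterated one; the integrand is
   nonnegative.  The exponent n + 2 s is 2 + 2 s in the plane. *)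
Definition interaction (R : realType) (s : R) (F G : set (plane R)) : \bar R :=
  (\int[leb2 R]_(x in F) \int[leb2 R]_(y in G)
     (eucl_dist x y `^ (- (2 + 2 * s)))%:E)%E.

Definition Per (R : realType) (s : R) (E Omega : set (plane R)) : \bar R :=
  (interaction s (E `&` Omega) (~` E)
   + interaction s (Omega `\` E) (E `\` Omega))%E.

Definition ae_eq_set (R : realType) (A B : set (plane R)) : Prop :=
  {ae leb2 R, forall x, A x <-> B x}.

(* Measurable means Borel here.  Every Lebesgue measurable set is a.e. equal to
   a Borel one, and Per is invariant under a.e. equality, so the classes modulo
   null sets are the same. *)
Definition admissible (R : realType) (Omega E0 E : set (plane R)) : Prop :=
  measurable E /\ ae_eq_set (E `\` Omega) E0.

Definition is_minimizer (R : realType) (s : R) (Omega E0 E : set (plane R)) :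
    Prop :=
  admissible Omega E0 E /\
  (forall F, admissible Omega E0 F -> (Per s E Omega <= Per s F Omega)%E).

Definition unit_ball (R : realType) : set (plane R) := [set x | eucl_norm x < 1].

Definition Sigma (R : realType) : set (plane R) :=
  [set x | ~ unit_ball x /\ 0 < x.1 /\ 0 < x.2].

(* Main.v *)
From HB Require Import structures.
Require Import Defs.
From mathcomp Require Import all_boot all_order all_algebra.
From mathcomp Require Import all_classical all_reals all_analysis.
From mathcomp Require Import measurable_realfun.
From mathcomp Require Import ring lra.
Import Order.TTheory GRing.Theory Num.Theory.
Import numFieldNormedType.Exports.
Local Open Scope classical_set_scope.
Local Open Scope ring_scope.

(** Write B for the unit ball, K for the kernel, A for the part inside B of a
    competitor F, and C for the complement of the union of Sigma and A.  The
    pairs of B \ A and Sigma enter both energies, so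
    [Per F - Per Sigma = L(A, C) - L(A, Sigma)] and everything reduces to
    [L(A, Sigma) + |A| <= L(A, C)], which is [energy_gap].

    The inequality cannot be checked point by point: near the arc that bounds
    Sigma, the attraction of Sigma wins.  It is obtained by a calibration.  The
    ball is swept by the arcs that bound the discs D_t of radius 1 and centre
    (-t, -t).  Every point x of B lies on exactly one of these circles, that of
    parameter [t = exit_time x], and D_t avoids both Sigma and all the points of
    smaller parameter.  Let [swept x] be the union of Sigma and of the points
    of B of parameter at most t.  The claim is that the nonlocal mean curvature of
    [swept x] at x is positive,
    [int_(swept x) k(x, y) dy + 1 <= int_(complement) k(x, y) dy],
    uniformly in x ([curvature_positive]).  Integrating this over A, the pairs
    inside A x A cancel by symmetry and what remains is the energy inequality
    ([calibration]).  Since K is not integrable on A x A, this is done for the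
    truncations min(K, n), and n tends to infinity afterwards.

    For the curvature, y and its mirror image 2 x - y have the same weight, so
    that only the y lying with their image on the same side contribute.
    Both in [swept x]: then y is outside D_t and outside its mirror image, two
    unit discs tangent at x, so at distance r from x such points fill a region of
    width of order r^2, and moreover they stay in a fixed square.  Their
    contribution is at most 2048 for every s <= 1/4 ([integral_narrow]).
    Both outside: this includes a full translated quadrant, whose contribution
    is of order 1/s and so at least 2049 for small s ([far_field_large]).

    Uniqueness needs in addition that [Per Sigma = L(B, Sigma)] is finite
    ([interaction_lty]): then a competitor of the same energy has [|A| = 0]. *)

Set Implicit Arguments.
Unset Strict Implicit.
Unset Printing Implicit Defensive.

(** * Countable covers, slices and reflections for plane Lebesgue measure *)

Lemma integral_indic_series_le d (T : measurableType d) (R : realType)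
    (mu : {measure set T -> \bar R}) (D : set T) (C : nat -> set T) (a : nat -> R) :
  measurable D -> (forall k, measurable (C k)) -> (forall k, 0 <= a k) ->
  (\int[mu]_(x in D) (\sum_(0 <= k <oo) (a k * \1_(C k) x)%:E) <=
   \sum_(0 <= k <oo) ((a k)%:E * mu (C k)))%E.
Proof.
move=> mD mC a0.
have mi k : measurable_fun D (\1_(C k) : T -> R) by exact: measurable_indic.
rewrite integral_nneseries//; last 2 first.
- by move=> k; apply/measurable_EFinP; exact: measurable_funM.
- by move=> k x _; rewrite lee_fin mulr_ge0// indicE ler0n.
apply: lee_nneseries => [k _ _|k _] /=.
  by apply: integral_ge0 => x _; rewrite lee_fin mulr_ge0// indicE ler0n.
under eq_integral do rewrite EFinM.
rewrite (@ge0_integralZl _ _ _ _ _ mD (fun x => (\1_(C k) x)%:E))//;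
  [|exact/measurable_EFinP|by rewrite lee_fin].
rewrite integral_indic//; apply: lee_wpmul2l; first by rewrite lee_fin.
by apply: le_measure; rewrite ?inE//; exact: measurableI.
Qed.

(** The upper bounds on singular integrals below are all of this form: on the
    dyadic piece [C k] the integrand is at most [a k]. *)
Lemma integral_le_cover d (T : measurableType d) (R : realType)
    (mu : {measure set T -> \bar R}) (D : set T) (f : T -> \bar R)
    (C : nat -> set T) (a : nat -> R) :
  measurable D -> measurable_fun D f -> (forall x, D x -> 0 <= f x)%E ->
  (forall k, measurable (C k)) -> (forall k, 0 <= a k) ->
  (forall x, D x -> (0 < f x)%E -> exists2 k, C k x & (f x <= (a k)%:E)%E) ->
  (\int[mu]_(x in D) f x <= \sum_(0 <= k <oo) ((a k)%:E * mu (C k)))%E.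
Proof.
move=> mD mf f0 mC a0 cov.
have g0 k x : (0 <= (a k * \1_(C k) x)%:E :> \bar R)%E.
  by rewrite lee_fin mulr_ge0// indicE ler0n.
apply: le_trans; last exact: (@integral_indic_series_le _ _ _ mu D C a).
apply: ge0_le_integral => //.
  apply: ge0_emeasurable_sum => // k _.
  by apply/measurable_EFinP; apply: measurable_funM => //; exact: measurable_indic.
move=> x Dx; have := f0 x Dx; rewrite le_eqVlt => /orP[/eqP <-|fx0].
  by apply: nneseries_ge0.
have [k Ckx fxa] := cov x Dx fx0; apply: (le_trans fxa).
apply: (@le_trans _ _ (\sum_(0 <= i < k.+1) (a i * \1_(C i) x)%:E)%E).
  by rewrite big_nat_recr//= indicE mem_set// mulr1 leeDr// sume_ge0.
exact: nneseries_lim_ge.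
Qed.

(** A nonempty set of diameter e lies in the closed interval of radius e around
    any of its points. *)
Lemma lebesgue_measure_le_diam (R : realType) (S : set (measurableTypeR R)) (e : R) :
  measurable S -> 0 <= e -> (forall u v, S u -> S v -> v - u <= e) ->
  (lebesgue_measure S <= (2 * e)%:E)%E.
Proof.
move=> mS e0 dS; have [->|/set0P[x Sx]] := eqVneq S set0.
  by rewrite measure0 lee_fin mulr_ge0.
apply: (@le_trans _ _ (lebesgue_measure (`[x - e, x + e]%classic : set R))).
  apply: le_measure; rewrite ?inE//.
  by move=> y Sy; rewrite /= in_itv/=; have := dS _ _ Sx Sy; have := dS _ _ Sy Sx; lra.
rewrite lebesgue_measure_itv/=; case: ifPn => _; rewrite lee_fin; lra.
Qed.

Lemma leb2_pushforward_prod (R : realType)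
    (f g : {mfun measurableTypeR R >-> measurableTypeR R}) :
  (forall A, measurable A -> lebesgue_measure (f @^-1` A) = lebesgue_measure A) ->
  (forall A, measurable A -> lebesgue_measure (g @^-1` A) = lebesgue_measure A) ->
  forall N : set (plane R), measurable N ->
  leb2 R ((fun p : plane R => (f p.1, g p.2)) @^-1` N) = leb2 R N.
Proof.
move=> fE gE N mN.
have mh : measurable_fun setT ((fun p => (f p.1, g p.2)) : plane R -> plane R).
  by apply: measurable_fun_pair; exact: measurableT_comp.
pose h : {mfun plane R >-> plane R} := HB.pack (fun p : plane R => (f p.1, g p.2))
  (isMeasurableFun.Build _ _ _ _ _ mh).
apply/esym/(@product_measure_unique _ _ _ _ _ _ _ (pushforward (leb2 R) h)) => // A B mA mB.
rewrite -[X in _ = (X * _)%E](fE A mA) -[X in _ = (_ * X)%E](gE B mB) -product_measure1E//.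
- by rewrite -(setTI (_ @^-1` _)); exact: measurable_funP.
- by rewrite -(setTI (_ @^-1` _)); exact: measurable_funP.
Qed.

Lemma leb2_swap (R : realType) (N : set (plane R)) : measurable N ->
  leb2 R ((fun p => (p.2, p.1)) @^-1` N) = leb2 R N.
Proof.
move=> mN.
have mh : measurable_fun setT ((fun p => (p.2, p.1)) : plane R -> plane R).
  exact: measurable_swap.
pose h : {mfun plane R >-> plane R} := HB.pack (fun p : plane R => (p.2, p.1))
  (isMeasurableFun.Build _ _ _ _ _ mh).
apply/esym/(@product_measure_unique _ _ _ _ _ _ _ (pushforward (leb2 R) h)) => // A B mA mB.
rewrite /pushforward muleC -product_measure1E//.
congr (product_measure1 _ _ _).
by apply/seteqP; split => -[x y] [].
Qed.

Lemma lebesgue_measure_reflect (R : realType) (a : R) (A : set (measurableTypeR R)) :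
  measurable A -> lebesgue_measure ((fun x => a - x) @^-1` A) = lebesgue_measure A.
Proof.
move=> mA.
have mh : measurable_fun setT ((fun x => a - x) : measurableTypeR R -> measurableTypeR R).
  exact: measurable_funB.
pose h : {mfun measurableTypeR R >-> measurableTypeR R} :=
  HB.pack (fun x : measurableTypeR R => a - x : measurableTypeR R)
  (isMeasurableFun.Build _ _ _ _ _ mh).
apply/esym/(@lebesgue_measure_unique _ (pushforward lebesgue_measure h)) => //= _ [[b c]] _ <-.
rewrite /pushforward/=.
rewrite (_ : _ @^-1` _ = `[a - c, a - b[%classic); last first.
  by apply/seteqP; split => x /=; rewrite !in_itv/=; lra.
rewrite !lebesgue_measure_itv/= !lte_fin ltrD2l ltrN2; case: ifPn => // _.
by rewrite -!EFinB; congr (_%:E); ring.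
Qed.

Definition reflect (R : realType) (x y : plane R) : plane R :=
  (2 * x.1 - y.1, 2 * x.2 - y.2).

Lemma measurable_reflect (R : realType) (x : plane R) : measurable_fun setT (reflect x).
Proof.
apply: measurable_fun_pair; apply: measurable_funB => //.
Qed.

(** Areas of regions with curved boundary are only needed up to a constant
    factor, so a bound on the diameter of the vertical slices suffices. *)
Lemma leb2_slices (R : realType) (N : set (plane R)) (u v e : R) :
  measurable N -> u <= v -> 0 <= e -> (forall p, N p -> u <= p.1 <= v) ->
  (forall p q, N p -> N q -> p.1 = q.1 -> q.2 - p.2 <= e) ->
  (leb2 R N <= ((v - u) * (2 * e))%:E)%E.
Proof.
move=> mN uv e0 Nuv dN; rewrite [leLHS]/product_measure1.
apply: (@le_trans _ _ (\int[lebesgue_measure]_(x in (`[u, v]%classic : set R))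
    (cst (2 * e)%:E x)))%E.
  rewrite [leRHS]integral_mkcond; apply: ge0_le_integral => //.
  - exact: measurable_fun_xsection.
  - exact/measurable_restrict.
  move=> x _; rewrite patchE; case: ifPn => [|xuv] /=.
    move=> _; apply: lebesgue_measure_le_diam => //.
      exact: measurable_xsection.
    by move=> y z; rewrite /xsection/= !inE => Ny Nz; exact: (dN (x, y) (x, z)).
  rewrite (_ : xsection N x = set0) ?measure0//.
  apply/seteqP; split => // y; rewrite /xsection/= inE => /Nuv/= xuv'.
  by move: xuv; rewrite notin_setE/= in_itv/= xuv'.
rewrite integral_cst// muleC (EFinM (v - u)); apply: lee_wpmul2r.
  by rewrite lee_fin mulr_ge0.
rewrite [leLHS](lebesgue_measure_itv `[u, v])/=; case: ifPn => _ //.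
by rewrite lee_fin subr_ge0.
Qed.

Lemma leb2_slices_swap (R : realType) (N : set (plane R)) (u v e : R) :
  measurable N -> u <= v -> 0 <= e -> (forall p, N p -> u <= p.2 <= v) ->
  (forall p q, N p -> N q -> p.2 = q.2 -> q.1 - p.1 <= e) ->
  (leb2 R N <= ((v - u) * (2 * e))%:E)%E.
Proof.
move=> mN uv e0 Nuv dN; rewrite -leb2_swap//; apply: leb2_slices => //.
- by rewrite -(setTI (_ @^-1` _)); exact: measurable_swap.
- by move=> p /= /Nuv.
- by move=> p q /= Np Nq pq; exact: (dN _ _ Np Nq).
Qed.

Lemma leb2_reflect (R : realType) (x : plane R) (N : set (plane R)) :
  measurable N -> leb2 R (reflect x @^-1` N) = leb2 R N.
Proof.
move=> mN.
have mh a : measurable_fun setT ((fun z => a - z) : measurableTypeR R -> measurableTypeR R).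
  exact: measurable_funB.
pose h a : {mfun measurableTypeR R >-> measurableTypeR R} :=
  HB.pack (fun z : measurableTypeR R => a - z : measurableTypeR R)
  (isMeasurableFun.Build _ _ _ _ _ (mh a)).
apply: (@leb2_pushforward_prod R (h (2 * x.1)) (h (2 * x.2))) => // A mA;
  exact: lebesgue_measure_reflect.
Qed.

Lemma integral_reflect (R : realType) (x : plane R) (D : set (plane R))
    (f : plane R -> \bar R) :
  measurable D -> measurable_fun D f -> (forall y, D y -> 0 <= f y)%E ->
  (\int[leb2 R]_(y in reflect x @^-1` D) f (reflect x y) =
   \int[leb2 R]_(y in D) f y)%E.
Proof.
move=> mD mf f0.
have mh := measurable_reflect x.
pose h : {mfun plane R >-> plane R} := HB.pack (reflect x)
  (isMeasurableFun.Build _ _ _ _ _ mh).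
transitivity (\int[pushforward (leb2 R) h]_(y in D) f y)%E.
  rewrite ge0_integral_pushforward//.
  by move=> y; rewrite inE; exact: f0.
apply: eq_measure_integral => A mA _; exact: leb2_reflect.
Qed.

Lemma leb2_box (R : realType) (a b c e : R) : a <= b -> c <= e ->
  leb2 R (`[a, b]%classic `*` `[c, e]%classic) = ((b - a) * (e - c))%:E.
Proof.
have len (u v : R) : u <= v ->
    lebesgue_measure (`[u, v]%classic : set (measurableTypeR R)) = (v - u)%:E.
  rewrite le_eqVlt => uv; rewrite [LHS](lebesgue_measure_itv `[u, v])/= lte_fin.
  by case/orP: uv => [/eqP ->|->//]; rewrite ltxx subrr.
move=> ab ce; rewrite [LHS]product_measure1E// EFinM.
by congr (_ * _)%E; exact: len.
Qed.

Lemma leb2_sigma_finite (R : realType) : sigma_finite setT (leb2 R).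
Proof.
exists (fun n : nat => `[- n%:R, n%:R]%classic `*` `[- n%:R, n%:R]%classic).
  apply/seteqP; split => // x _.
  have xn (u : R) n : (Num.bound `|u| <= n)%N -> u \in `[- n%:R, n%:R]%R.
    move=> un; rewrite in_itv/= -ler_norml.
    by rewrite (le_trans (ltW (archi_boundP (normr_ge0 u))))// ler_nat.
  exists (maxn (Num.bound `|x.1|) (Num.bound `|x.2|)) => //.
  by split; apply: xn; rewrite ?leq_maxl ?leq_maxr.
move=> n; split; first exact: measurableX.
have n0 : (0 : R) <= n%:R by [].
by rewrite leb2_box ?ltry//; lra.
Qed.

(** The product measure bundled with its sigma-finiteness, which is the form in
    which Tonelli's theorem takes it. *)
Definition plane_measure (R : realType) : {sigma_finite_measure set (plane R) -> \bar R} :=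
  HB.pack (leb2 R) (Measure_isSigmaFinite.Build _ _ _ (leb2 R) (@leb2_sigma_finite R)).

(** * Calibration for bounded symmetric kernels *)

Section sections.
Context d (T : measurableType d) (R : realType).
Variable mu : {sigma_finite_measure set T -> \bar R}.
Variable k : T * T -> \bar R.
Hypotheses (mk : measurable_fun setT k) (k0 : forall z, (0 <= k z)%E).
Local Open Scope ereal_scope.

Lemma integral_xsection (S : set (T * T)) x :
  \int[mu]_(y in xsection S x) k (x, y) = \int[mu]_y (k \_ S) (x, y).
Proof.
rewrite integral_mkcond; apply: eq_integral => y _.
by rewrite !patchE mem_xsection.
Qed.

Lemma integral_ysection (S : set (T * T)) y :
  \int[mu]_(x in ysection S y) k (x, y) = \int[mu]_x (k \_ S) (x, y).
Proof.
rewrite integral_mkcond; apply: eq_integral => x _.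
by rewrite !patchE mem_ysection.
Qed.

Let kS_ge0 (S : set (T * T)) z : 0 <= (k \_ S) z.
Proof. by rewrite patchE; case: ifP. Qed.

Let mkS (S : set (T * T)) : measurable S -> measurable_fun setT (k \_ S).
Proof. by move=> mS; apply/(measurable_restrictT _ _).1 => //; exact: measurable_funTS. Qed.

Lemma measurable_integral_xsection (S : set (T * T)) : measurable S ->
  measurable_fun setT (fun x => \int[mu]_(y in xsection S x) k (x, y)).
Proof.
move=> mS; under eq_fun do rewrite integral_xsection.
by apply: (@measurable_fun_fubini_tonelli_F _ _ _ _ _ mu (k \_ S)) => //; exact: mkS.
Qed.

Lemma tonelli_section (S : set (T * T)) : measurable S ->
  \int[mu]_x \int[mu]_(y in xsection S x) k (x, y) =
  \int[mu]_y \int[mu]_(x in ysection S y) k (x, y).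
Proof.
move=> mS; under eq_integral do rewrite integral_xsection.
under [RHS]eq_integral do rewrite integral_ysection.
by apply: (@fubini_tonelli _ _ _ _ _ mu mu (k \_ S)) => //; exact: mkS.
Qed.

Lemma measurable_integral_fixed (G : set T) : measurable G ->
  measurable_fun setT (fun x => \int[mu]_(y in G) k (x, y)).
Proof.
move=> mG; have := measurable_integral_xsection (measurableX measurableT mG).
congr (measurable_fun _ _); apply/funext => x; rewrite in_xsectionX//.
exact: in_setT.
Qed.

End sections.

Section calibration.
Context d (T : measurableType d) (R : realType).
Variable mu : {sigma_finite_measure set T -> \bar R}.
Variables (k : T * T -> \bar R) (M : R).
Hypotheses (mk : measurable_fun setT k) (kb : forall z, (0 <= k z)%E /\ (k z <= M%:E)%E).
Hypothesis ksym : forall x y, k (x, y) = k (y, x).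
Variables (phi : T -> R) (A S : set T) (c : R).
Hypotheses (mphi : measurable_fun setT phi) (mA : measurable A) (mS : measurable S).
Hypotheses (AS : A `&` S = set0) (muA : (mu A < +oo)%E) (c0 : 0 <= c).
Local Open Scope ereal_scope.

Let U := [set z : T * T | [/\ A z.1, A z.2 & (phi z.2 <= phi z.1)%R]].
Let V := [set z : T * T | [/\ A z.1, A z.2 & (phi z.1 <= phi z.2)%R]].

Let mU : measurable U.
Proof.
rewrite (_ : U = (A `*` A) `&` [set z | (phi z.2 <= phi z.1)%R]).
  apply: measurableI; first exact: measurableX.
  rewrite -[X in measurable X]setTI.
  by apply: (@measurable_fun_le _ _ _ setT (phi \o snd) (phi \o fst)) => //;
    exact: measurableT_comp.
by apply/seteqP; split => z /=; [move=> []|move=> [[]]].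
Qed.

Let mV : measurable V.
Proof.
rewrite (_ : V = (A `*` A) `&` [set z | (phi z.1 <= phi z.2)%R]).
  apply: measurableI; first exact: measurableX.
  rewrite -[X in measurable X]setTI.
  by apply: (@measurable_fun_le _ _ _ setT (phi \o fst) (phi \o snd)) => //;
    exact: measurableT_comp.
by apply/seteqP; split => z /=; [move=> []|move=> [[]]].
Qed.

Let VU : \int[mu]_(x in A) \int[mu]_(y in xsection V x) k (x, y) <=
         \int[mu]_(x in A) \int[mu]_(y in xsection U x) k (x, y).
Proof.
have extend W : (forall z, W z -> A z.1) ->
    \int[mu]_(x in A) \int[mu]_(y in xsection W x) k (x, y) =
    \int[mu]_x \int[mu]_(y in xsection W x) k (x, y).
  move=> WA; rewrite integral_mkcond; apply: eq_integral => x _.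
  rewrite patchE; case: ifPn => // /negP xA.
  rewrite (_ : xsection W x = set0) ?integral_set0//.
  rewrite xsectionE; apply/seteqP; split => y // /WA Ax.
  by case: xA; exact: mem_set.
rewrite !extend; [|by move=> z []|by move=> z []].
rewrite tonelli_section; [|exact: mk|by move=> z; exact: (kb z).1|exact: mV].
rewrite le_eqVlt; apply/orP; left; apply/eqP; apply: eq_integral => x _.
rewrite (_ : ysection V x = xsection U x).
  by apply: eq_integral => y _; rewrite ksym.
by rewrite xsectionE ysectionE; apply/seteqP; split => y [].
Qed.

Let Voo : \int[mu]_(x in A) \int[mu]_(y in xsection V x) k (x, y) < +oo.
Proof.
have M0 : 0 <= M%:E := le_trans (kb (point, point)).1 (kb (point, point)).2.
apply: (@le_lt_trans _ _ (\int[mu]_(x in A) (cst (M%:E * mu A)) x)).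
  apply: ge0_le_integral.
  - exact: mA.
  - by move=> x _; apply: integral_ge0 => y _; exact: (kb _).1.
  - apply: measurable_funTS; apply: measurable_integral_xsection;
      [exact: mk|by move=> z; exact: (kb z).1|exact: mV].
  - exact: measurable_cst.
  move=> x Ax; apply: (@le_trans _ _ (\int[mu]_(y in A) cst M%:E y)); last first.
    by rewrite integral_cst.
  apply: (@le_trans _ _ (\int[mu]_(y in xsection V x) cst M%:E y)).
    apply: ge0_le_integral.
    - exact: measurable_xsection.
    - by move=> y _; exact: (kb _).1.
    - by apply: measurable_funTS; exact: measurableT_comp.
    - exact: measurable_cst.
    - by move=> y _; exact: (kb _).2.
  apply: ge0_subset_integral.
  - exact: measurable_xsection.
  - exact: mA.
  - exact: measurable_cst.
  - by move=> y _; exact: M0.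
  - by rewrite xsectionE => y [].
rewrite integral_cst//; have fA : mu A \is a fin_num by rewrite ge0_fin_numE.
by apply: lte_mul_pinfty; [exact: mule_ge0|exact: fin_numM|].
Qed.

(** [phi] is the parameter of the sweep, and the hypothesis is the positivity of
    the mean curvature of the sets swept at time [phi x].  Integrated over x in
    A, it has on the left the pairs of A with [phi y <= phi x] and on the right
    those with [phi x <= phi y].  Exchanging x and y maps the first onto the
    second, so they cancel; boundedness of k makes them finite.  The ties
    [phi y = phi x] are on both sides, so that level sets of any measure cancel. *)
Lemma calibration :
  (forall x, A x ->
    \int[mu]_(y in S `|` (A `&` [set y | (phi y <= phi x)%R])) k (x, y) + c%:E <=
    \int[mu]_(y in ~` (S `|` (A `&` [set y | (phi y < phi x)%R]))) k (x, y)) ->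
  \int[mu]_(x in A) \int[mu]_(y in S) k (x, y) + c%:E * mu A <=
  \int[mu]_(x in A) \int[mu]_(y in ~` (S `|` A)) k (x, y).
Proof.
move=> H.
have i0 (B : set T) x : 0 <= \int[mu]_(y in B) k (x, y).
  by apply: integral_ge0 => y _; exact: (kb _).1.
have fV : \int[mu]_(x in A) \int[mu]_(y in xsection V x) k (x, y) \is a fin_num.
  rewrite ge0_fin_numE; first exact: Voo.
  by apply: integral_ge0 => x _; exact: i0.
rewrite -(leeD2rE _ _ fV); apply: (le_trans (leeD2l _ VU)).
have ms G : measurable G -> measurable_fun A (fun x => \int[mu]_(y in G) k (x, y)).
  move=> mG; apply: measurable_funTS; apply: measurable_integral_fixed;
    [exact: mk|by move=> z; exact: (kb z).1|exact: mG].
have mx W : measurable W ->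
    measurable_fun A (fun x => \int[mu]_(y in xsection W x) k (x, y)).
  move=> mW; apply: measurable_funTS; apply: measurable_integral_xsection;
    [exact: mk|by move=> z; exact: (kb z).1|exact: mW].
have mC : measurable (~` (S `|` A)) by apply: measurableC; exact: measurableU.
have c0' : 0 <= c%:E by rewrite lee_fin; exact: c0.
rewrite -(@integral_cst _ _ _ mu A); last exact: mA.
rewrite -ge0_integralD; [|exact: mA|by move=> x _; exact: i0|exact: ms|
  by move=> x _; exact: c0'|exact: measurable_cst].
rewrite -ge0_integralD; [|exact: mA|by move=> x _; exact: adde_ge0|
  by apply: emeasurable_funD; [exact: ms|exact: measurable_cst]|
  by move=> x _; exact: i0|exact: mx].
rewrite -ge0_integralD; [|exact: mA|by move=> x _; exact: i0|exact: ms|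
  by move=> x _; exact: i0|exact: mx].
apply: ge0_le_integral.
- exact: mA.
- by move=> x _; apply: adde_ge0 => //; apply: adde_ge0.
- apply: emeasurable_funD; last exact: mx.
  by apply: emeasurable_funD; [exact: ms|exact: measurable_cst].
- by apply: emeasurable_funD; [exact: ms|exact: mx].
move=> x Ax; rewrite addeAC.
have mle : measurable (A `&` [set y | (phi y <= phi x)%R]).
  rewrite (_ : _ `&` _ = xsection U x); first exact: measurable_xsection.
  by rewrite xsectionE; apply/seteqP; split => y /=; [case|case].
have mge : measurable (A `&` [set y | (phi x <= phi y)%R]).
  rewrite (_ : _ `&` _ = xsection V x); first exact: measurable_xsection.
  by rewrite xsectionE; apply/seteqP; split => y /=; [case|case].
have mkx D : measurable_fun D (fun y => k (x, y)).
  by apply: measurable_funTS; exact: measurableT_comp.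
have -> : xsection U x = A `&` [set y | (phi y <= phi x)%R].
  by rewrite xsectionE; apply/seteqP; split => y /=; [case|case].
have -> : xsection V x = A `&` [set y | (phi x <= phi y)%R].
  by rewrite xsectionE; apply/seteqP; split => y /=; [case|case].
rewrite -ge0_integral_setU; [|exact: mS|exact: mle|exact: mkx|
  by move=> y _; exact: (kb _).1|]; last first.
  by apply/disj_setPS => y [Sy [Ay _]]; have : (A `&` S) y by []; rewrite AS.
rewrite -ge0_integral_setU; [|exact: mC|exact: mge|exact: mkx|
  by move=> y _; exact: (kb _).1|]; last first.
  by apply/disj_setPS => y [nSA [Ay _]]; apply: nSA; right.
have -> : ~` (S `|` A) `|` A `&` [set y | (phi x <= phi y)%R] =
    ~` (S `|` (A `&` [set y | (phi y < phi x)%R])); last exact: H.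
  apply/seteqP; split => y.
  + move=> [nSA [Sy|[Ay _]]|[Ay /= xy] [Sy|[_ /=]]].
    * by apply: nSA; left.
    * by apply: nSA; right.
    * by have : (A `&` S) y by []; rewrite AS.
    * by rewrite ltNge xy.
  + move=> nS; have [Ay|nAy] := pselect (A y).
      right; split => //=; rewrite leNgt; apply/negP => yx.
      by apply: nS; right.
    by left => -[Sy|//]; apply: nS; left.
Qed.
End calibration.

(** * The kernel *)

Definition kernel (R : realType) (s : R) (x y : plane R) : R :=
  eucl_dist x y `^ (- (2 + 2 * s)).

Section kernel_bounds.
Context (R : realType).
Implicit Types (x y : plane R) (s e r : R).

Lemma measurable_sqrt : measurable_fun [set: R] (@Num.sqrt R).
Proof. by apply: continuous_measurable_fun; exact: sqrt_continuous. Qed.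

Lemma eucl_dist_ge0 x y : 0 <= eucl_dist x y.
Proof. exact: sqrtr_ge0. Qed.

Lemma sqr_eucl_dist x y :
  eucl_dist x y ^+ 2 = (x.1 - y.1) ^+ 2 + (x.2 - y.2) ^+ 2.
Proof. by rewrite sqr_sqrtr// addr_ge0// sqr_ge0. Qed.

Lemma eucl_distC x y : eucl_dist x y = eucl_dist y x.
Proof.
by rewrite /eucl_dist /eucl_norm/= -(sqrrN (x.1 - y.1)) -(sqrrN (x.2 - y.2)) !opprB.
Qed.

Lemma eucl_dist_reflect x y : eucl_dist x (reflect x y) = eucl_dist x y.
Proof. by rewrite /eucl_dist /eucl_norm/=; congr (Num.sqrt _); ring. Qed.

Lemma eucl_dist_leP x y r : 0 <= r ->
  (eucl_dist x y <= r) = ((x.1 - y.1) ^+ 2 + (x.2 - y.2) ^+ 2 <= r ^+ 2).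
Proof. by move=> r0; rewrite -sqr_eucl_dist ler_sqr ?nnegrE ?eucl_dist_ge0. Qed.

Lemma ge_eucl_distP x y r : 0 <= r ->
  (r <= eucl_dist x y) = (r ^+ 2 <= (x.1 - y.1) ^+ 2 + (x.2 - y.2) ^+ 2).
Proof. by move=> r0; rewrite -sqr_eucl_dist ler_sqr ?nnegrE ?eucl_dist_ge0. Qed.

Lemma unit_ballE x : unit_ball x <-> x.1 ^+ 2 + x.2 ^+ 2 < 1.
Proof.
rewrite /unit_ball /eucl_norm/= -[X in _ < X]sqrtr1 ltr_sqrt ?ltr01//.
Qed.

Lemma kernel_ge0 s x y : 0 <= kernel s x y.
Proof. exact: powR_ge0. Qed.

Lemma kernelC s x y : kernel s x y = kernel s y x.
Proof. by rewrite /kernel eucl_distC. Qed.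

Lemma kernel_reflect s x y : kernel s x (reflect x y) = kernel s x y.
Proof. by rewrite /kernel eucl_dist_reflect. Qed.

Lemma measurable_kernel s :
  measurable_fun setT (fun z : plane R * plane R => kernel s z.1 z.2).
Proof.
apply: (measurableT_comp (measurable_powR _)).
apply: (measurableT_comp measurable_sqrt) => /=.
by apply: measurable_funD; apply: measurable_funX; apply: measurable_funB;
  do ?apply: measurableT_comp.
Qed.

Lemma kernel_inv s x y : kernel s x y = (eucl_dist x y)^-1 `^ (2 + 2 * s).
Proof.
rewrite /kernel -[(eucl_dist x y)^-1]powR_inv1 ?eucl_dist_ge0//.
by rewrite -powRrM mulN1r.
Qed.

Lemma kernel_gt0_dist s x y : 0 <= s -> 0 < kernel s x y -> 0 < eucl_dist x y.
Proof.
move=> s0 k0; rewrite lt_neqAle eucl_dist_ge0 andbT eq_sym.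
apply: contraTneq k0 => e0; rewrite /kernel e0 powR0 ?ltxx// oppr_eq0 gt_eqF//; lra.
Qed.

(** The exponent 2 + 2 s is at most 5/2, and 4 ^ (5/2) = 32, whence a bound that is
    uniform in s. *)
Lemma kernel_le_near s x y n : 0 < s <= 1 / 4 -> (4 ^- n) <= eucl_dist x y ->
  kernel s x y <= 32 ^+ n.
Proof.
move=> s0 ne; have n0 : 0 < 4 ^- n :> R by rewrite invr_gt0 exprn_gt0.
have e0 := lt_le_trans n0 ne.
rewrite kernel_inv; apply: (@le_trans _ _ ((4 ^+ n) `^ (2 + 2 * s))).
  apply: ge0_ler_powR; rewrite ?nnegrE ?invr_ge0 ?eucl_dist_ge0 ?exprn_ge0//.
    by lra.
  by rewrite -[leRHS]invrK lef_pV2.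
apply: (@le_trans _ _ ((4 ^+ n) `^ (5 / 2))).
  apply: ler_powR; last by lra.
  by rewrite exprn_ege1//; lra.
rewrite (_ : 4 ^+ n = (2 ^+ n) `^ 2%:R :> R); last first.
  by rewrite powR_mulrn ?exprn_ge0// -exprM mulnC exprM; congr (_ ^+ _); ring.
rewrite -powRrM (_ : 2%:R * (5 / 2) = 5%:R :> R); last by lra.
rewrite powR_mulrn ?exprn_ge0// -exprM mulnC exprM le_eqVlt.
by apply/orP; left; apply/eqP; congr (_ ^+ _); ring.
Qed.

Lemma kernel_le_far s x y n : 0 < s -> 2 ^+ n <= eucl_dist x y ->
  kernel s x y <= 4 ^- n * (2 `^ (- (2 * s))) ^+ n.
Proof.
move=> s0 ne; have n0 : 0 < 2 ^+ n :> R by rewrite exprn_gt0.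
have e0 := lt_le_trans n0 ne.
rewrite kernel_inv; apply: (@le_trans _ _ ((2 ^- n) `^ (2 + 2 * s))).
  apply: ge0_ler_powR; rewrite ?nnegrE ?invr_ge0 ?eucl_dist_ge0 ?exprn_ge0//.
    by lra.
  by rewrite lef_pV2.
rewrite -[2 ^- n]powR_invn// -powRrM.
rewrite (_ : - n%:R * (2 + 2 * s) = - (2 * n)%:R + (- (2 * s)) * n%:R); last first.
  by rewrite natrM; ring.
rewrite powRD; last by apply/implyP => _; rewrite pnatr_eq0.
rewrite powR_invn// powRrM powR_mulrn ?powR_ge0//.
rewrite exprM (_ : 2 ^+ 2 = 4 :> R)//; ring.
Qed.

(** Up to scale [2 ^ n] with [n <= 1 / (2 s)], the kernel is comparable to the
    critical kernel |x - y| ^ -2, whose integral diverges at infinity. *)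
Lemma kernel_ge s x y n : 0 < s -> 0 < eucl_dist x y <= 2 ^+ n ->
  2 * s * n%:R <= 1 -> 4 ^- n / 2 <= kernel s x y.
Proof.
move=> s0 /andP[e0 en] sn; have n0 : 0 < 2 ^+ n :> R by rewrite exprn_gt0.
rewrite kernel_inv; apply: (@le_trans _ _ ((2 ^- n) `^ (2 + 2 * s))); last first.
  apply: ge0_ler_powR; rewrite ?nnegrE ?invr_ge0 ?eucl_dist_ge0 ?exprn_ge0//.
    by lra.
  by rewrite lef_pV2.
rewrite -[2 ^- n]powR_invn// -powRrM.
rewrite (_ : - n%:R * (2 + 2 * s) = - (2 * n)%:R - (2 * s * n%:R)); last first.
  by rewrite natrM; ring.
rewrite powRD; last by apply/implyP => _; rewrite pnatr_eq0.
rewrite powR_invn// exprM (_ : 2 ^+ 2 = 4 :> R); last by ring.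
rewrite ler_wpM2l ?invr_ge0 ?exprn_ge0// powRN lef_pV2 ?posrE ?powR_gt0//.
by rewrite -[leRHS](@powRr1 _ 2)//; apply: ler_powR => //; lra.
Qed.

Lemma dyadic_bracket (b e : R) : 2 <= b -> 1 <= e ->
  exists n, b ^+ n <= e < b ^+ n.+1.
Proof.
move=> b2 e1.
have ex : exists n, e < b ^+ n.
  exists (Num.bound e); apply: (lt_le_trans (archi_boundP _)); first by lra.
  apply: (@le_trans _ _ (2 ^+ Num.bound e)).
    by rewrite -natrX ler_nat ltnW// ltn_expl.
  by apply: lerXn2r; rewrite ?nnegrE//; lra.
case: (ex_minnP ex) => -[|n] en min; first by move: en; rewrite expr0; lra.
exists n; rewrite en andbT leNgt; apply/negP => /min.
by rewrite ltnn.
Qed.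

End kernel_bounds.

(** * Sweeping the ball by unit circles *)

Lemma measurable_set_le d (T : measurableType d) (R : realType) (f g : T -> R) :
  measurable_fun setT f -> measurable_fun setT g -> measurable [set z | f z <= g z].
Proof.
by move=> mf mg; rewrite -[X in measurable X]setTI; exact: measurable_fun_le.
Qed.

Lemma measurable_set_lt d (T : measurableType d) (R : realType) (f g : T -> R) :
  measurable_fun setT f -> measurable_fun setT g -> measurable [set z | f z < g z].
Proof.
move=> mf mg; rewrite (_ : [set _ | _] = ~` [set z | g z <= f z]).
  by apply: measurableC; exact: measurable_set_le.
by apply/seteqP; split => z /=; rewrite real_ltNge ?num_real// => /negP.
Qed.

(** The positive root t of [|x + t (1, 1)| = 1]: the time at which x leaves the
    unit disc when it moves along the diagonal. *)
Definition exit_time (R : realType) (x : plane R) : R :=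
  (Num.sqrt ((x.1 + x.2) ^+ 2 + 2 * (1 - (x.1 ^+ 2 + x.2 ^+ 2)))
   - (x.1 + x.2)) / 2.

Section geometry.
Context (R : realType).
Implicit Types (x y : plane R) (t s : R).

Lemma measurable_exit_time : measurable_fun [set: plane R] (@exit_time R).
Proof.
have mD : measurable_fun [set: plane R]
    (fun x => (x.1 + x.2) ^+ 2 + 2 * (1 - (x.1 ^+ 2 + x.2 ^+ 2)) : R).
  apply: measurable_funD; first by apply: measurable_funX; exact: measurable_funD.
  apply: measurable_funM => //; apply: measurable_funB => //.
  by apply: measurable_funD; exact: measurable_funX.
apply: measurable_funM => //; apply: measurable_funB; last exact: measurable_funD.
exact: (measurableT_comp (@measurable_sqrt R) mD).
Qed.

Lemma measurable_unit_ball : measurable (@unit_ball R).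
Proof.
rewrite (_ : @unit_ball R = [set x | x.1 ^+ 2 + x.2 ^+ 2 < 1]).
  apply: measurable_set_lt => //.
  by apply: measurable_funD; exact: measurable_funX.
by apply/seteqP; split => x /unit_ballE.
Qed.

Lemma measurable_Sigma : measurable (@Sigma R).
Proof.
rewrite (_ : @Sigma R = ~` (@unit_ball R) `&`
  ([set x | 0 < x.1] `&` [set x | 0 < x.2])) //.
apply: measurableI; first by apply: measurableC; exact: measurable_unit_ball.
by apply: measurableI; exact: measurable_set_lt.
Qed.

Lemma exit_timeP x : unit_ball x -> 0 < exit_time x /\
  (x.1 + exit_time x) ^+ 2 + (x.2 + exit_time x) ^+ 2 = 1.
Proof.
move=> /unit_ballE xB; rewrite /exit_time.
set D := _ + 2 * _; set q := Num.sqrt D.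
have D0 : (x.1 + x.2) ^+ 2 < D by rewrite /D; lra.
have q2 : q ^+ 2 = D by rewrite sqr_sqrtr// ltW// (le_lt_trans _ D0)// sqr_ge0.
have q0 : 0 <= q by exact: sqrtr_ge0.
split; last by move: q2; rewrite /D; lra.
rewrite divr_gt0// subr_gt0 ltNge; apply/negP => qx.
suff : q ^+ 2 <= (x.1 + x.2) ^+ 2 by rewrite q2; lra.
by apply: lerXn2r; rewrite ?nnegrE//; lra.
Qed.

Lemma exit_time_out y t : unit_ball y -> exit_time y <= t ->
  1 <= (y.1 + t) ^+ 2 + (y.2 + t) ^+ 2.
Proof.
move=> yB yt; have [_ <-] := exit_timeP yB.
have h : 0 <= 2 * exit_time y + (y.1 + y.2).
  rewrite /exit_time.
  by have := sqrtr_ge0 ((y.1 + y.2) ^+ 2 + 2 * (1 - (y.1 ^+ 2 + y.2 ^+ 2))); lra.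
move: (exit_time y) yt h => p pt h.
rewrite -subr_ge0.
have -> : (y.1 + t) ^+ 2 + (y.2 + t) ^+ 2 - ((y.1 + p) ^+ 2 + (y.2 + p) ^+ 2) =
  2 * ((t - p) * ((2 * p + (y.1 + y.2)) + (t - p))) by ring.
by apply: mulr_ge0 => //; apply: mulr_ge0; lra.
Qed.

(** Moving a point of the positive quadrant along (1, 1) increases its norm. *)
Lemma Sigma_out y t : Sigma y -> 0 <= t -> 1 <= (y.1 + t) ^+ 2 + (y.2 + t) ^+ 2.
Proof.
move=> [yB [y1 y2]] t0; have : 1 <= y.1 ^+ 2 + y.2 ^+ 2.
  by rewrite leNgt; apply/negP => /unit_ballE.
by have := mulr_ge0 (ltW y1) t0; have := mulr_ge0 (ltW y2) t0; nra.
Qed.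

(** The points of a square of half-side r around x that are at distance at most
    q from the line through x with unit normal (a, b). *)
Definition strip x (a b r q : R) : set (plane R) :=
  [set y | [/\ `|y.1 - x.1| <= r, `|y.2 - x.2| <= r
             & `|a * (y.1 - x.1) + b * (y.2 - x.2)| <= q] ].

Lemma measurable_strip x a b r q : measurable (strip x a b r q).
Proof.
have mn (f : plane R -> R) c : measurable_fun setT f -> measurable [set y | `|f y| <= c].
  by move=> mf; apply: measurable_set_le => //; exact: measurableT_comp.
have m1 : measurable_fun setT (fun y : plane R => y.1 - x.1 : R) by exact: measurable_funB.
have m2 : measurable_fun setT (fun y : plane R => y.2 - x.2 : R) by exact: measurable_funB.
rewrite (_ : strip _ _ _ _ _ = [set y | `|y.1 - x.1| <= r] `&`
  ([set y | `|y.2 - x.2| <= r] `&` [set y | `|a * (y.1 - x.1) + b * (y.2 - x.2)| <= q])).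
  apply: measurableI; first exact: mn.
  apply: measurableI; first exact: mn.
  by apply: mn; apply: measurable_funD; exact: measurable_funM.
by apply/seteqP; split => y; [case|case=> ? []].
Qed.

Lemma slope_bound (a p q : R) : 1 / 4 <= a ^+ 2 -> `|a * p| <= q -> p <= 2 * q.
Proof.
move=> a4; rewrite ler_norml => /andP[h1 h2].
have q0 : 0 <= q by lra.
rewrite leNgt; apply/negP => pq.
have p0 : 0 < p by lra.
have : (a * p) ^+ 2 <= q ^+ 2 by nra.
rewrite exprMn; nra.
Qed.

(** One of the two components of the unit normal is at least 1/2 in absolute
    value; slicing along the corresponding axis, the slices have diameter at
    most 4 q. *)
Lemma leb2_strip x a b r q : a ^+ 2 + b ^+ 2 = 1 -> 0 <= r -> 0 <= q ->
  (leb2 R (strip x a b r q) <= (16 * (r * q))%:E)%E.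
Proof.
move=> ab r0 q0; have [b4|b4] := lerP (1 / 4) (b ^+ 2).
  apply: (@le_trans _ _ (((x.1 + r) - (x.1 - r)) * (2 * (4 * q)))%:E); last first.
    by rewrite lee_fin; lra.
  apply: leb2_slices.
  - exact: measurable_strip.
  - by lra.
  - by lra.
  - by move=> p [] + _ _; rewrite ler_norml; lra.
  move=> p p' [_ _ h] [_ _ h'] pp'.
  rewrite (_ : 4 * q = 2 * (2 * q)); last by ring.
  apply: (slope_bound b4); move: h h'; rewrite !ler_norml -pp'; nra.
have a4 : 1 / 4 <= a ^+ 2 by lra.
apply: (@le_trans _ _ (((x.2 + r) - (x.2 - r)) * (2 * (4 * q)))%:E); last first.
  by rewrite lee_fin; lra.
apply: leb2_slices_swap.
- exact: measurable_strip.
- by lra.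
- by lra.
- by move=> p [] _ + _; rewrite ler_norml; lra.
move=> p p' [_ _ h] [_ _ h'] pp'.
rewrite (_ : 4 * q = 2 * (2 * q)); last by ring.
apply: (slope_bound a4); move: h h'; rewrite !ler_norml -pp'; nra.
Qed.

End geometry.

(** * The symmetric part of a swept set is narrow *)

Section curvature.
Context (R : realType).
Implicit Types (x y : plane R) (s t : R) (E : set (plane R)).

Lemma measurable_kernel_snd s x : measurable_fun setT (fun y => (kernel s x y)%:E).
Proof.
apply/measurable_EFinP.
exact: (measurableT_comp (@measurable_kernel R s) (pair1_measurable x)).
Qed.

Lemma measurable_preimage_reflect x E : measurable E -> measurable (reflect x @^-1` E).
Proof. by move=> mE; rewrite -(setTI (_ @^-1` _)); exact: measurable_reflect. Qed.

Lemma reflectK x : involutive (reflect x).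
Proof. by case=> a b; rewrite /reflect/=; congr (_, _); ring. Qed.

(** The reflection exchanges the points of E whose image is outside E with the
    points outside E whose image is in E, and preserves the integrand; those
    contributions cancel. *)
Lemma integral_compl_ge x (E : set (plane R)) (f : plane R -> \bar R) (c : R) :
  measurable E -> measurable_fun setT f -> (forall y, 0 <= f y)%E ->
  (forall y, f (reflect x y) = f y) ->
  (\int[leb2 R]_(y in E `&` reflect x @^-1` E) f y + c%:E <=
   \int[leb2 R]_(y in ~` E `&` reflect x @^-1` (~` E)) f y)%E ->
  (\int[leb2 R]_(y in E) f y + c%:E <= \int[leb2 R]_(y in ~` E) f y)%E.
Proof.
move=> mE mf f0 fr h.
have mE' := measurable_preimage_reflect x mE.
have mfD (D : set (plane R)) : measurable_fun D f by exact: measurable_funTS.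
have split (P Q : set (plane R)) : measurable P -> measurable Q ->
    (\int[leb2 R]_(y in P) f y = \int[leb2 R]_(y in P `&` Q) f y +
      \int[leb2 R]_(y in P `&` ~` Q) f y)%E.
  move=> mP mQ; rewrite -ge0_integral_setU.
  - by rewrite -setIUr setUv setIT.
  - exact: measurableI.
  - by apply: measurableI => //; exact: measurableC.
  - exact: mfD.
  - by move=> y _; exact: f0.
  - by apply/disj_setPS => y [[_ Qy] [_]].
rewrite (split E (reflect x @^-1` E))// (split (~` E) (~` (reflect x @^-1` E))).
- rewrite setCK addeAC; apply: leeD; first by rewrite -preimage_setC in h *.
  rewrite -[leLHS](integral_reflect x) //; last first.
    by apply: measurableI => //; exact: measurableC.
  under eq_integral do rewrite fr.
  rewrite le_eqVlt; apply/orP; left; apply/eqP; congr (integral _ _ _).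
  apply/seteqP; split => y /=; rewrite reflectK => -[]//.
- exact: measurableC.
- exact: measurableC.
Qed.

(** With z = y - x and nu the outer unit normal at x of the unit disc centred at
    (-t, -t), being outside the two tangent discs means |z + nu| >= 1 and
    |z - nu| >= 1, that is 2 |z . nu| <= |z| ^ 2. *)
Lemma strip_of_tangent_discs x t s y n : (x.1 + t) ^+ 2 + (x.2 + t) ^+ 2 = 1 ->
  1 <= (y.1 + t) ^+ 2 + (y.2 + t) ^+ 2 ->
  1 <= ((reflect x y).1 + t) ^+ 2 + ((reflect x y).2 + t) ^+ 2 ->
  eucl_dist x y <= 4 ^- n ->
  strip x (x.1 + t) (x.2 + t) (4 ^- n) (16 ^- n) y.
Proof.
move=> x1 y1 y2 xy.
have n0 : 0 <= 4 ^- n :> R by rewrite invr_ge0 exprn_ge0.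
have e4 : 16 ^- n = (4 ^- n) ^+ 2 :> R.
  by rewrite -exprVn -[in RHS]exprVn -exprM mulnC exprM; by congr (_ ^+ _); field.
move: xy; rewrite eucl_dist_leP// => xy; rewrite /strip/= e4.
set q := 4 ^- n in n0 xy *.
have sq (u : R) : u ^+ 2 <= q ^+ 2 -> `|u| <= q.
  by move=> uq; rewrite ler_norml; apply/andP; split; nra.
split.
- by apply: sq; have := sqr_ge0 (x.2 - y.2); nra.
- by apply: sq; have := sqr_ge0 (x.1 - y.1); nra.
- by move: y1 y2; rewrite /= ler_norml => y1 y2; apply/andP; split; nra.
Qed.

(** At scale 4 ^ -n the region is in a strip of area at most 16 * 64 ^ -n, on
    which the kernel is at most 32 ^ (n + 1): a convergent series, with sum
    independent of s.  At distance at least 1 the kernel is at most 1 and the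
    region is contained in a square of side 4. *)
Lemma integral_narrow x t s E : 0 < s <= 1 / 4 ->
  unit_ball x -> (x.1 + t) ^+ 2 + (x.2 + t) ^+ 2 = 1 -> measurable E ->
  (forall y, E y -> 1 <= (y.1 + t) ^+ 2 + (y.2 + t) ^+ 2) ->
  (forall y, E y -> -1 < y.1 /\ -1 < y.2) ->
  (\int[leb2 R]_(y in E `&` reflect x @^-1` E) (kernel s x y)%:E <= 2048%:E)%E.
Proof.
move=> s4 xB xt mE Eout Eq.
(* Piece 0 is the part at distance at least 1 from x; piece n.+1 is the part at
   distance between 4 ^ -(n + 1) and 4 ^ -n. *)
pose C (n : nat) := if n is m.+1 then strip x (x.1 + t) (x.2 + t) (4 ^- m) (16 ^- m)
  else (`[-1, 3]%classic `*` `[-1, 3]%classic : set (plane R)).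
pose a (n : nat) : R := if n is m.+1 then 32 ^+ m.+1 else 1.
have mC n : measurable (C n).
  by case: n => [|n] /=; [exact: measurableX|exact: measurable_strip].
have a0 n : 0 <= a n by case: n => [|n] //=; rewrite exprn_ge0.
apply: le_trans.
  apply: (@integral_le_cover _ _ _ (leb2 R) _ _ C a) => //.
  - by apply: measurableI => //; exact: measurable_preimage_reflect.
  - by apply: measurable_funTS; exact: measurable_kernel_snd.
  - by move=> y _; rewrite lee_fin kernel_ge0.
  move=> y [Ey Ey']; rewrite lte_fin => /kernel_gt0_dist e0.
  have {}e0 : 0 < eucl_dist x y by apply: e0; lra.
  have [e1|e1] := lerP 1 (eucl_dist x y).
    exists 0%N => /=.
      move: xB => /unit_ballE xB; have [] := Eq _ Ey'; have [] := Eq _ Ey.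
      by rewrite /= !in_itv/=; nra.
    by have := @kernel_le_near R s x y 0 s4; rewrite expr0 invr1 lee_fin => /(_ e1).
  have /(@dyadic_bracket R 4) : 1 <= (eucl_dist x y)^-1 by rewrite invf_ge1// ltW.
  case=> [|n /andP[n1 n2]]; first by lra.
  exists n.+1 => /=.
    apply: strip_of_tangent_discs => //; [exact: Eout|exact: Eout|].
    by rewrite -[leLHS]invrK lef_pV2 ?posrE ?invr_gt0// exprn_gt0.
  rewrite lee_fin; apply: kernel_le_near => //.
  by rewrite -[leRHS]invrK lef_pV2 ?posrE ?invr_gt0// ?exprn_gt0// ltW.
have := @epsilon_trick0 R 2048 xpredT.
move=> /(_ (ler0n _ _)); apply: le_trans; apply: lee_nneseries.
  by move=> n _ _; rewrite mule_ge0// lee_fin.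
move=> [|n] _ /=.
  by rewrite mul1e leb2_box ?lee_fin; lra.
apply: (@le_trans _ _ ((32 ^+ n.+1)%:E * (16 * (4 ^- n * 16 ^- n))%:E)%E).
  apply: lee_wpmul2l; first by rewrite lee_fin exprn_ge0.
  by apply: leb2_strip => //; rewrite invr_ge0 exprn_ge0.
rewrite -EFinM lee_fin natrX.
have -> : 32 ^+ n.+1 * (16 * (4 ^- n * 16 ^- n)) = 512 * (2 ^- n) :> R.
  rewrite (_ : 2 ^- n = 32 ^+ n * (4 ^- n * 16 ^- n)); last first.
    by rewrite -!exprVn -!exprMn; congr (_ ^+ _); field.
  by rewrite exprS; ring.
rewrite !exprS !invfM; lra.
Qed.

End curvature.

(** * The far field blows up as s tends to 0 *)

Section far_field.
Context (R : realType).
Implicit Types (x y : plane R) (s : R).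

(* The ratio 3 / 2 between the right end of a square and the left end of the
   preceding one makes these closed squares disjoint. *)
Let square (k : nat) : set (plane R) :=
  `[- (2 ^+ k.+3), - (3 * 2 ^+ k.+1)]%classic `*` `[2 ^+ k.+2, 2 ^+ k.+3]%classic.

Let pow2_ge1 k : 1 <= 2 ^+ k :> R.
Proof. by rewrite exprn_ege1//; lra. Qed.

Let leb2_square k : leb2 R (square k) = (4 ^+ k * 8)%:E.
Proof.
have p1 := pow2_ge1 k; rewrite leb2_box; rewrite !exprS; [|lra|lra].
by congr (_%:E); rewrite -[4]/(2 * 2)%:R natrM exprMn; ring.
Qed.

Let square_disjoint : trivIset setT square.
Proof.
apply/trivIsetP => i j _ _ ij; wlog ij' : i j ij / (i < j)%N.
  by move=> h; case: (ltngtP i j) ij => // ij _; [|rewrite setIC]; apply: h;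
    rewrite ?(gtn_eqF ij) ?(ltn_eqF ij).
apply/seteqP; split => // -[a b] [] [] /=; rewrite !in_itv/= => ai _ [] /=.
rewrite !in_itv/= => aj _.
have : 2 ^+ i.+1 <= 2 ^+ j :> R by rewrite ler_weXn2l//; lra.
move: ai aj; rewrite !exprS => /andP[ai1 ai2] /andP[aj1 aj2] ij2.
by exfalso; have := pow2_ge1 i; lra.
Qed.

Let square_dist x y k : unit_ball x -> square k y -> 0 < eucl_dist x y <= 2 ^+ k.+4.
Proof.
move=> /unit_ballE xB [] /=; rewrite !in_itv/= => /andP[a1 a2] /andP[b1 b2].
have p1 := pow2_ge1 k; rewrite !exprS in a1 a2 b1 b2.
have x1 : - 1 < x.1 < 1 by apply/andP; split; nra.
have x2 : - 1 < x.2 < 1 by apply/andP; split; nra.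
case/andP: x1 x2 => x1 x1' /andP[x2 x2'].
apply/andP; split.
  apply: (@lt_le_trans _ _ 1) => //; rewrite ge_eucl_distP//.
  have : 1 <= x.1 - y.1 by lra.
  by have := sqr_ge0 (x.2 - y.2); nra.
rewrite eucl_dist_leP ?exprn_ge0// !exprS.
move: (2 ^+ k) p1 a1 a2 b1 b2 => p p1 a1 a2 b1 b2.
have h1 : (x.1 - y.1) ^+ 2 <= (9 * p) ^+ 2.
  by apply: lerXn2r; rewrite ?nnegrE; lra.
have h2 : (x.2 - y.2) ^+ 2 <= (9 * p) ^+ 2.
  by rewrite -sqrrN; apply: lerXn2r; rewrite ?nnegrE; lra.
rewrite expr0 mulr1; nra.
Qed.

(** Each dyadic square of the second quadrant contributes at least 1/64 as long
    as its index is at most of order 1/s, so the number of useful squares, and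
    with it the integral, grows without bound as s tends to 0. *)
Lemma far_field_large (M : R) : exists so : R, 0 < so <= 1 / 4 /\
  forall s x (D : set (plane R)) (f : plane R -> \bar R), 0 < s <= so -> unit_ball x ->
    measurable D -> measurable_fun setT f -> (forall y, 0 <= f y)%E ->
    (forall y, y.1 <= - 4 -> 4 <= y.2 -> D y /\ ((kernel s x y)%:E <= f y)%E) ->
    (M%:E <= \int[leb2 R]_(y in D) f y)%E.
Proof.
pose N := Num.bound (64 * `|M|).
have NM : 64 * `|M| < N%:R by apply: archi_boundP; rewrite mulr_ge0.
have N0 : 0 <= N%:R :> R by [].
(* This choice gives 2 s (k + 4) <= 1 for the N squares k < N, which are all
   within distance 2 ^ (k + 4) of x. *)
exists ((2 * (N%:R + 4))^-1); split.
  rewrite invr_gt0 (_ : 1 / 4 = 4^-1); last by lra.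
  by rewrite lef_pV2 ?posrE; lra.
move=> s x D f /andP[s0 sN] xB mD mf f0 fD.
have msq k : measurable (square k) by exact: measurableX.
have sqQ k y : square k y -> y.1 <= - 4 /\ 4 <= y.2.
  move=> [] /=; rewrite !in_itv/= !exprS => /andP[a1 a2] /andP[b1 b2].
  by have := pow2_ge1 k; lra.
pose W := \big[setU/set0]_(k <- index_iota 0 N) square k.
apply: (@le_trans _ _ (\int[leb2 R]_(y in W) f y)%E); last first.
  apply: ge0_subset_integral => //.
  - exact: bigsetU_measurable.
  - exact: measurable_funTS.
  rewrite /W -bigcup_seq => y [k _] /sqQ[y1 y2].
  by have [] := fD y y1 y2.
rewrite ge0_integral_bigsetU//; first last.
- exact: measurable_funTS.
- exact: sub_trivIset square_disjoint.
- exact: iota_uniq.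
apply: (@le_trans _ _ (\sum_(0 <= k < N) (1 / 64)%:E)%E).
  rewrite sumEFin sumr_const_nat subn0 lee_fin -mulr_natr.
  by have := ler_norm M; lra.
rewrite big_seq [leRHS]big_seq; apply: lee_sum => k; rewrite mem_index_iota => /andP[_ kN].
apply: (@le_trans _ _ (\int[leb2 R]_(y in square k) cst (4 ^- k.+4 / 2)%:E y)%E).
  rewrite integral_cst// [X in (_ * X)%E](leb2_square k) -EFinM lee_fin !exprS !invfM.
  have p0 : 4 ^+ k != 0 :> R by rewrite expf_neq0.
  by rewrite le_eqVlt; apply/orP; left; apply/eqP; field.
apply: ge0_le_integral => //.
- by move=> y _; rewrite lee_fin divr_ge0// invr_ge0 exprn_ge0.
- exact: measurable_funTS.
move=> y sy; have [y1 y2] := sqQ _ _ sy; have [_] := fD y y1 y2; apply: le_trans.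
rewrite lee_fin; apply: kernel_ge => //; first exact: square_dist.
have kN' : k.+4%:R <= N%:R + 4 :> R.
  by rewrite -(natrD R N 4) ler_nat addn4 !ltnS ltnW.
apply: (@le_trans _ _ (2 * s * (N%:R + 4))); first by apply: ler_wpM2l => //; lra.
have := ler_wpM2r (_ : 0 <= 2 * (N%:R + 4)) sN.
by rewrite mulVf; [|lra]; move=> /(_ _); lra.
Qed.

End far_field.

(** * Positive curvature and the energy gap *)

Section energy.
Context (R : realType).
Implicit Types (x y : plane R) (s : R) (A : set (plane R)).

Lemma measurable_inner_integral s G : measurable G ->
  measurable_fun setT (fun x => \int[leb2 R]_(y in G) (kernel s x y)%:E)%E.
Proof.
move=> mG.
apply: (@measurable_integral_fixed _ _ _ (plane_measure R) (fun z => (kernel s z.1 z.2)%:E)).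
- by apply/measurable_EFinP; exact: measurable_kernel.
- by move=> z; rewrite lee_fin kernel_ge0.
- exact: mG.
Qed.

Lemma inner_integral_ge0 s G x : (0 <= \int[leb2 R]_(y in G) (kernel s x y)%:E)%E.
Proof. by apply: integral_ge0 => y _; rewrite lee_fin kernel_ge0. Qed.

(** The set that has been swept when the moving circle reaches x. *)
Definition swept x : set (plane R) :=
  @Sigma R `|` (@unit_ball R `&` [set y | exit_time y <= exit_time x]).

(** [f] stands for the truncated kernels: truncation lowers the contribution of
    the narrow region and does not change the far field. *)
Lemma curvature_positive : exists so : R, 0 < so <= 1 / 4 /\
  forall s x (f : plane R -> \bar R), 0 < s <= so -> unit_ball x ->
    measurable_fun setT f -> (forall y, 0 <= f y)%E ->
    (forall y, f (reflect x y) = f y) ->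
    (forall y, f y <= (kernel s x y)%:E)%E ->
    (forall y, 1 <= eucl_dist x y -> f y = (kernel s x y)%:E) ->
    (\int[leb2 R]_(y in swept x) f y + 1%:E <=
     \int[leb2 R]_(y in ~` swept x) f y)%E.
Proof.
have [so [/andP[so0 so4] far]] := far_field_large (2049 : R).
exists so; split; first by rewrite so0.
move=> s x f /andP[s0 sso] xB mf f0 fr fK fK1; set E := swept x.
have [t0 xt] := exit_timeP xB.
have mE : measurable E.
  apply: measurableU; first exact: measurable_Sigma.
  apply: measurableI; first exact: measurable_unit_ball.
  by apply: measurable_set_le => //; exact: measurable_exit_time.
have Eout y : E y -> 1 <= (y.1 + exit_time x) ^+ 2 + (y.2 + exit_time x) ^+ 2.
  case=> [yS|[yB yx]]; first by apply: Sigma_out => //; exact: ltW.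
  exact: exit_time_out.
have Eq y : E y -> -1 < y.1 /\ -1 < y.2.
  case=> [[_ [y1 y2]]|[/unit_ballE yB _]]; first by split; lra.
  by split; nra.
apply: (@integral_compl_ge R x) => //.
apply: (@le_trans _ _ (2048%:E + 1%:E)%E).
  apply: leeD => //; apply: (@le_trans _ _ (\int[leb2 R]_(y in E `&` reflect x @^-1` E)
      (kernel s x y)%:E)%E).
    apply: ge0_le_integral => //.
    - by apply: measurableI => //; exact: measurable_preimage_reflect.
    - exact: measurable_funTS.
    - by apply: measurable_funTS; exact: measurable_kernel_snd.
  apply: (@integral_narrow R x (exit_time x)) => //.
  by rewrite s0/=; lra.
rewrite -EFinD (_ : 2048 + 1 = 2049 :> R); last by lra.
have mCE : measurable (~` E) by exact: measurableC.
apply: (far s x) => //.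
- by rewrite s0.
- by apply: measurableI => //; exact: measurable_preimage_reflect.
move: xB => /unit_ballE xB.
have x1 : -1 < x.1 < 1 by apply/andP; split; nra.
have x2 : -1 < x.2 < 1 by apply/andP; split; nra.
move=> y y1 y2; split; last first.
  rewrite fK1// ge_eucl_distP//.
  have : 1 <= x.1 - y.1 by case/andP: x1; lra.
  by have := sqr_ge0 (x.2 - y.2); nra.
split.
- by move=> /Eq[]; lra.
- by move=> /= /Eq/= []; lra.
Qed.

(** The truncation level is at least 1, so that the kernel is unchanged at
    distance at least 1. *)
Definition cut_kernel s (n : nat) (z : plane R * plane R) : \bar R :=
  (Num.min (kernel s z.1 z.2) n.+1%:R)%:E.

Lemma measurable_cut_kernel s n : measurable_fun setT (cut_kernel s n).
Proof.
apply/measurable_EFinP; apply: measurable_minr => //; exact: measurable_kernel.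
Qed.

Lemma cut_kernel_bounds s n z :
  (0 <= cut_kernel s n z)%E /\ (cut_kernel s n z <= n.+1%:R%:E)%E.
Proof.
by rewrite /cut_kernel !lee_fin le_min kernel_ge0 ler0n ge_min lexx orbT.
Qed.

Lemma cut_kernel_le s n x y : (cut_kernel s n (x, y) <= (kernel s x y)%:E)%E.
Proof. by rewrite lee_fin ge_min lexx. Qed.

Lemma nondecreasing_cut_kernel s z :
  {homo (cut_kernel s)^~ z : m n / (m <= n)%N >-> (m <= n)%E}.
Proof.
move=> m n mn; rewrite lee_fin le_min !ge_min lexx/=.
by rewrite (_ : m.+1%:R <= n.+1%:R) ?orbT// ler_nat.
Qed.

Lemma lim_cut_kernel s x y :
  limn (fun n => cut_kernel s n (x, y)) = (kernel s x y)%:E.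
Proof.
apply: lim_near_cst => //; near=> n; congr (_%:E).
apply/min_idPl; rewrite /=; apply/ltW.
apply: (lt_le_trans (archi_boundP (kernel_ge0 s x y))).
by rewrite ler_nat; near: n; exists (Num.bound (kernel s x y)) => // n /= /leqW.
Unshelve. all: by end_near. Qed.

Lemma measurable_integral_cut s n A (D : set (plane R)) : measurable D ->
  measurable_fun A (fun x => \int[leb2 R]_(y in D) cut_kernel s n (x, y))%E.
Proof.
move=> mD.
apply: measurable_funTS; exact: (@measurable_integral_fixed _ _ _ (plane_measure R)
  (cut_kernel s n) (@measurable_cut_kernel s n) (fun z => (cut_kernel_bounds s n z).1) D mD).
Qed.

Lemma interaction_cut s A (D : set (plane R)) : measurable A -> measurable D ->
  interaction s A D = limn (fun n =>
    \int[leb2 R]_(x in A) \int[leb2 R]_(y in D) cut_kernel s n (x, y))%E.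
Proof.
move=> mA mD.
have mk n (x : plane R) (B : set (plane R)) :
    measurable_fun B (fun y => cut_kernel s n (x, y)).
  by apply: measurable_funTS; apply: (measurableT_comp (@measurable_cut_kernel s n)).
have k0 n z : (0 <= cut_kernel s n z)%E := (cut_kernel_bounds s n z).1.
have i0 n x : (0 <= \int[leb2 R]_(y in D) cut_kernel s n (x, y))%E.
  by apply: integral_ge0 => y _; exact: k0.
rewrite -(@monotone_convergence _ _ _ (leb2 R) A); first last.
- move=> x _ m n mn; apply: ge0_le_integral.
  + exact: mD.
  + by move=> y _; exact: k0.
  + exact: mk.
  + exact: mk.
  + by move=> y _; exact: nondecreasing_cut_kernel.
- by move=> n x _; exact: i0.
- by move=> n; exact: (@measurable_integral_cut s n A D mD).
- exact: mA.
apply: eq_integral => x _; rewrite -(@monotone_convergence _ _ _ (leb2 R) D).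
- by apply: eq_integral => y _; rewrite lim_cut_kernel.
- exact: mD.
- by move=> n; exact: mk.
- by move=> n y _; exact: k0.
- by move=> y _; exact: nondecreasing_cut_kernel.
Qed.

Lemma leb2_unit_ball_lty A : A `<=` @unit_ball R -> measurable A -> (leb2 R A < +oo)%E.
Proof.
move=> AB mA; apply: (@le_lt_trans _ _ (leb2 R (`[-1, 1]%classic `*` `[-1, 1]%classic))).
  apply: le_measure; rewrite ?inE//; first exact: measurableX.
  move=> x /AB/unit_ballE xB; split; rewrite /= in_itv/=; apply/andP; split; nra.
by rewrite leb2_box ?ltry//; lra.
Qed.

(** The mean curvature inequality, integrated over A by calibration for each
    truncation, and passed to the limit by monotone convergence. *)
Lemma energy_gap : exists so : R, 0 < so <= 1 / 4 /\
  forall s A, 0 < s <= so -> measurable A -> A `<=` @unit_ball R ->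
  (interaction s A (@Sigma R) + leb2 R A <= interaction s A (~` (@Sigma R `|` A)))%E.
Proof.
have [so [so0 curv]] := curvature_positive.
exists so; split => // s A sso mA AB.
have mS := @measurable_Sigma R.
have mC : measurable (~` (@Sigma R `|` A)) by apply: measurableC; exact: measurableU.
have Afin := leb2_unit_ball_lty AB mA.
have fA : leb2 R A \is a fin_num by rewrite ge0_fin_numE.
have mphi := @measurable_exit_time R.
have mcut n (x : plane R) (B : set (plane R)) :
    measurable_fun B (fun y => cut_kernel s n (x, y)).
  by apply: measurable_funTS; apply: (measurableT_comp (@measurable_cut_kernel s n)).
have cut0 n z : (0 <= cut_kernel s n z)%E := (cut_kernel_bounds s n z).1.
have i0 n (B : set (plane R)) x : (0 <= \int[leb2 R]_(y in B) cut_kernel s n (x, y))%E.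
  by apply: integral_ge0 => y _; exact: cut0.
have mi n (B : set (plane R)) : measurable B ->
    measurable_fun A (fun x => \int[leb2 R]_(y in B) cut_kernel s n (x, y))%E.
  by move=> mB; exact: (@measurable_integral_cut s n A B mB).
rewrite -leeBrDr; last exact: fA.
rewrite interaction_cut; [|exact: mA|exact: mS].
apply: lime_le.
  apply: ereal_nondecreasing_is_cvgn => m n mn.
  apply: ge0_le_integral; [exact: mA|by move=> x _; exact: i0|exact: mi|exact: mi|].
  move=> x _; apply: ge0_le_integral;
    [exact: mS|by move=> y _; exact: cut0|exact: mcut|exact: mcut|].
  by move=> y _; exact: nondecreasing_cut_kernel.
apply: nearW => n; rewrite leeBrDr; last exact: fA.
apply: (@le_trans _ _ (\int[leb2 R]_(x in A) \int[leb2 R]_(y in ~` (@Sigma R `|` A))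
    cut_kernel s n (x, y))%E); last first.
  apply: ge0_le_integral; [exact: mA|by move=> x _; exact: i0|exact: mi| |].
    exact: (measurable_funTS (@measurable_inner_integral s _ mC)).
  move=> x _; apply: ge0_le_integral;
    [exact: mC|by move=> y _; exact: cut0|exact: mcut| |].
    by apply: measurable_funTS; exact: measurable_kernel_snd.
  by move=> y _; exact: cut_kernel_le.
rewrite -[X in (_ + X)%E]mul1e.
apply: (@calibration _ _ _ (plane_measure R) (cut_kernel s n) n.+1%:R _ _ _
  (@exit_time R) A (@Sigma R) 1).
- exact: measurable_cut_kernel.
- by move=> z; exact: cut_kernel_bounds.
- by move=> x y; rewrite /cut_kernel/= kernelC.
- exact: mphi.
- exact: mA.
- exact: mS.
- by apply/seteqP; split => // y [/AB yB [nyB _]]; exact: nyB.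
- exact: Afin.
- exact: ler01.
move=> x Ax.
have := curv s x (fun y => cut_kernel s n (x, y)) sso (AB _ Ax) (mcut n x setT).
move=> /(_ (fun y => cut0 n (x, y))).
have kr y : cut_kernel s n (x, reflect x y) = cut_kernel s n (x, y).
  by rewrite /cut_kernel/= kernel_reflect.
move=> /(_ kr (cut_kernel_le s n x)).
have k1 y : 1 <= eucl_dist x y -> cut_kernel s n (x, y) = (kernel s x y)%:E.
  move=> xy; congr (_%:E); apply/min_idPl => /=.
  apply: (@le_trans _ _ 1); last by rewrite ler1n.
  have : 0 < s <= 1 / 4 by move: sso so0; lra.
  by move=> /(@kernel_le_near R s x y 0); rewrite expr0 invr1; apply.
move=> /(_ k1) /=.
have mle : measurable [set y | exit_time y <= exit_time x] by exact: measurable_set_le.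
have mlt : measurable [set y | exit_time y < exit_time x] by exact: measurable_set_lt.
have mB := @measurable_unit_ball R.
rewrite /swept; set E := @Sigma R `|` _ => h.
have mE : measurable E by apply: measurableU => //; exact: measurableI.
apply: le_trans; [|apply: le_trans; [exact: h|]].
  apply: leeD; last exact: lexx.
  apply: ge0_subset_integral.
  - by apply: measurableU => //; exact: measurableI.
  - exact: mE.
  - exact: mcut.
  - by move=> y _; exact: cut0.
  - by apply: setUS; exact: setSI.
apply: ge0_subset_integral.
- exact: measurableC.
- by apply: measurableC; apply: measurableU => //; exact: measurableI.
- exact: mcut.
- by move=> y _; exact: cut0.
by apply: subsetC; apply: setUS => y [/AB yB /ltW yx]; split.
Qed.

End energy.

(** * The perimeter of Sigma is finite *)

Section finiteness.
Context (R : realType).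
Implicit Types (x y : plane R) (s r : R).

Let box x r : set (plane R) :=
  `[x.1 - r, x.1 + r]%classic `*` `[x.2 - r, x.2 + r]%classic.

Let measurable_box x r : measurable (box x r).
Proof. exact: measurableX. Qed.

Let leb2_boxE x r : 0 <= r -> leb2 R (box x r) = (4 * r ^+ 2)%:E.
Proof. by move=> r0; rewrite leb2_box; [congr (_%:E); ring|lra|lra]. Qed.

Let mem_box_dist x y r : 0 <= r -> eucl_dist x y <= r -> box x r y.
Proof.
move=> r0; rewrite eucl_dist_leP// => xy; split; rewrite /= in_itv/=.
- by have := sqr_ge0 (x.2 - y.2); move=> h; apply/andP; split; nra.
- by have := sqr_ge0 (x.1 - y.1); move=> h; apply/andP; split; nra.
Qed.

Lemma measurable_eucl_dist_snd x : measurable_fun setT (eucl_dist x).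
Proof.
apply: (@measurableT_comp _ _ _ _ _ _ (@Num.sqrt R) setT
  (fun y : plane R => (x.1 - y.1) ^+ 2 + (x.2 - y.2) ^+ 2)); first exact: measurable_sqrt.
by apply: measurable_funD; apply: measurable_funX; apply: measurable_funB.
Qed.

(** Dyadic rings of ratio 2: the areas grow like 4 ^ n, which the factor 4 ^ -n of
    the kernel compensates; the remaining series is geometric of ratio
    2 ^ (- 2 s) < 1. *)
Lemma far_integral_le s x D : 0 < s -> measurable D ->
  (forall y, D y -> 1 <= eucl_dist x y) ->
  (\int[leb2 R]_(y in D) (kernel s x y)%:E <= (16 / (1 - 2 `^ (- (2 * s))))%:E)%E.
Proof.
move=> s0 mD far; set rho := 2 `^ _.
have rho0 : 0 <= rho by exact: powR_ge0.
have rho1 : rho < 1.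
  rewrite /rho powRN invf_lt1 ?powR_gt0//.
  have s2 : 0 < 2 * s by lra.
  have := @gt0_ltr_powR R _ s2 1 2; rewrite powR1 !nnegrE; apply => //.
  by lra.
apply: le_trans.
  apply: (@integral_le_cover _ _ _ (leb2 R) _ _ (fun n => box x (2 ^+ n.+1))
    (fun n => 4 ^- n * rho ^+ n)) => //.
  - by apply: measurable_funTS; exact: measurable_kernel_snd.
  - by move=> y _; rewrite lee_fin kernel_ge0.
  - by move=> n /=; rewrite mulr_ge0 ?invr_ge0 ?exprn_ge0.
  move=> y /far/(@dyadic_bracket R 2)-/(_ (lexx _))[n /andP[n1 /ltW n2]] _.
  exists n; first by apply: mem_box_dist => //; rewrite exprn_ge0.
  by rewrite lee_fin; exact: kernel_le_far.
apply: lime_le.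
  by apply: is_cvg_nneseries => n _ _; rewrite mule_ge0// lee_fin mulr_ge0 ?invr_ge0 ?exprn_ge0.
apply: nearW => N.
rewrite (eq_bigr (fun n => (16 * rho ^+ n)%:E)); last first.
  move=> n _; rewrite [X in (_ * X)%E]leb2_boxE ?exprn_ge0// -EFinM.
  have p0 : 4 ^+ n != 0 :> R by rewrite expf_neq0.
  rewrite [2 ^+ n.+1]exprS exprMn -exprM mulnC exprM (_ : 2 ^+ 2 = 4 :> R); last by ring.
  by congr (_%:E); field.
rewrite sumEFin lee_fin -mulr_sumr ler_wpM2l// big_mkord.
rewrite -[leRHS]mul1r ler_pdivlMr; last by lra.
have := subrX1 rho N; have : 0 <= rho ^+ N by rewrite exprn_ge0.
move: (\sum_(i < N) _) (rho ^+ N) => S q; nra.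
Qed.

(** The points of the ball that can be at distance at most r from Sigma.  The
    factor 3 comes from [|y| >= 1], [|x - y| <= r] and [r <= 1], which give
    [|x| ^ 2 >= 1 - 2 r - r ^ 2]. *)
Definition layer r : set (plane R) :=
  [set x | [/\ x.1 ^+ 2 + x.2 ^+ 2 < 1, 1 - 3 * r <= x.1 ^+ 2 + x.2 ^+ 2,
     - r <= x.1 & - r <= x.2]].

Let half_layer r : set (plane R) := layer r `&` [set x | x.2 <= x.1].

Let measurable_sqnorm : measurable_fun setT (fun x : plane R => x.1 ^+ 2 + x.2 ^+ 2 : R).
Proof. by apply: measurable_funD; exact: measurable_funX. Qed.

Lemma measurable_layer r : measurable (layer r).
Proof.
rewrite (_ : layer r = [set x | x.1 ^+ 2 + x.2 ^+ 2 < 1] `&`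
  ([set x | 1 - 3 * r <= x.1 ^+ 2 + x.2 ^+ 2] `&`
   ([set x | - r <= x.1] `&` [set x | - r <= x.2]))).
  apply: measurableI; first exact: measurable_set_lt.
  by do 2 (apply: measurableI; first exact: measurable_set_le); exact: measurable_set_le.
by apply/seteqP; split => x; [case|case=> ? [? []]].
Qed.

Let half_layer_slice r x y : 0 <= r -> half_layer r x -> half_layer r y -> x.2 = y.2 ->
  y.1 - x.1 <= 32 * r.
Proof.
move=> r0 [[x1 x2 x3 x4] /= x5] [[y1 y2 y3 y4] /= y5] xy; rewrite -xy in y1 y2 y4 y5.
have [r16|r16] := lerP (1 / 16) r.
  have : y.1 <= 1 by have := sqr_ge0 x.2; nra.
  have : - 1 <= x.1 by have := sqr_ge0 x.2; nra.
  by lra.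
have big (u : R) : x.2 <= u -> - r <= u -> 1 - 3 * r <= u ^+ 2 + x.2 ^+ 2 -> 1 / 2 <= u.
  move=> xu ru h; have [x0|x0] := lerP 0 x.2; first by nra.
  have : x.2 ^+ 2 <= 1 / 16 by nra.
  move=> h2; have : 1 / 4 <= u ^+ 2 by lra.
  by nra.
have bx := big x.1 x5 x3 x2; have b_y := big y.1 y5 y3 y2.
have : (y.1 - x.1) * (y.1 + x.1) <= 3 * r by nra.
nra.
Qed.

(** By the symmetry in the diagonal it suffices to consider [x.2 <= x.1].  There
    [x.1] is bounded below, so that the horizontal slices of this part of the
    annulus are of length of order r when r is small; for the other r the
    diameter of the ball is enough. *)
Lemma leb2_layer r : 0 <= r -> (leb2 R (layer r) <= (256 * r)%:E)%E.
Proof.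
move=> r0.
have mh : measurable (half_layer r).
  by apply: measurableI; [exact: measurable_layer|exact: measurable_set_le].
have mh' : measurable ((fun p => (p.2, p.1)) @^-1` half_layer r : set (plane R)).
  by rewrite -(setTI (_ @^-1` _)); exact: measurable_swap.
have h : (leb2 R (half_layer r) <= (128 * r)%:E)%E.
  rewrite (_ : 128 * r = (1 - (- 1)) * (2 * (32 * r))); last by ring.
  apply: leb2_slices_swap; [exact: mh|lra|lra| |].
    move=> x [[x1 _ _ _] _]; have := sqr_ge0 x.1 => x2.
    by apply/andP; split; nra.
  by move=> x y hx hy xy; exact: half_layer_slice.
apply: (@le_trans _ _ (leb2 R (half_layer r `|` (fun p => (p.2, p.1)) @^-1` half_layer r))).
  apply: le_measure; rewrite ?inE.
  - exact: measurable_layer.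
  - exact: measurableU.
  move=> x lx; have [xx|/ltW xx] := lerP x.2 x.1; first by left.
  by right; case: lx => x1 x2 x3 x4; split => //=; split => //=; rewrite [x.2 ^+ 2 + _]addrC.
apply: (le_trans (measureU2 _ _ _)) => //.
rewrite (_ : 256 * r = 128 * r + 128 * r); last by ring.
by rewrite EFinD; apply: leeD; [exact: h|rewrite [leLHS]leb2_swap].
Qed.

Lemma layer_near x y r : 0 <= r <= 1 -> unit_ball x -> Sigma y -> eucl_dist x y <= r ->
  layer r x.
Proof.
move=> /andP[r0 r1] /unit_ballE xB [yB [y1 y2]]; rewrite eucl_dist_leP// => xy.
have yn : 1 <= y.1 ^+ 2 + y.2 ^+ 2 by rewrite leNgt; apply/negP => /unit_ballE.
have a1 : y.1 - x.1 <= r by have := sqr_ge0 (x.2 - y.2); nra.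
have a2 : y.2 - x.2 <= r by have := sqr_ge0 (x.1 - y.1); nra.
split; [by []| |lra|lra].
set a := y.1 - x.1; set b := y.2 - x.2.
have ab : a ^+ 2 + b ^+ 2 <= r ^+ 2 by rewrite /a /b; nra.
have yE : y.1 ^+ 2 + y.2 ^+ 2 =
    x.1 ^+ 2 + x.2 ^+ 2 + 2 * (x.1 * a + x.2 * b) + (a ^+ 2 + b ^+ 2).
  by rewrite /a /b; ring.
suff : x.1 * a + x.2 * b <= r by rewrite yE in yn; nra.
have cs : (x.1 * a + x.2 * b) ^+ 2 <= (x.1 ^+ 2 + x.2 ^+ 2) * (a ^+ 2 + b ^+ 2).
  have := sqr_ge0 (x.1 * b - x.2 * a); nra.
have : (x.1 * a + x.2 * b) ^+ 2 <= r ^+ 2.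
  apply: (le_trans cs); have := sqr_ge0 a; have := sqr_ge0 b; nra.
move: (x.1 * a + x.2 * b) => c c2; nra.
Qed.

(** A point x interacts at scale 4 ^ -n with Sigma only if it is in the layer of
    that width; this is what makes the sum integrable in x. *)
Lemma near_integral_le s x D : 0 < s <= 1 / 4 -> unit_ball x -> measurable D ->
  D `<=` @Sigma R -> (forall y, D y -> eucl_dist x y < 1) ->
  (\int[leb2 R]_(y in D) (kernel s x y)%:E <=
   \sum_(0 <= n <oo) (128 * 2 ^+ n * \1_(layer (4 ^- n)) x)%:E)%E.
Proof.
move=> s4 xB mD DS near.
apply: le_trans.
  apply: (@integral_le_cover _ _ _ (leb2 R) _ _ (fun n => box x (4 ^- n))
    (fun n => 32 ^+ n.+1 * \1_(layer (4 ^- n)) x)) => //.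
  - by apply: measurable_funTS; exact: measurable_kernel_snd.
  - by move=> y _; rewrite lee_fin kernel_ge0.
  move=> y Dy; rewrite lte_fin => /kernel_gt0_dist e0.
  have {}e0 : 0 < eucl_dist x y by apply: e0; lra.
  have : 1 <= (eucl_dist x y)^-1 by rewrite invf_ge1// ltW// near.
  move=> /(@dyadic_bracket R 4)[|n /andP[n1 n2]]; first by lra.
  have n4 : eucl_dist x y <= 4 ^- n.
    by rewrite -[leLHS]invrK lef_pV2 ?posrE ?invr_gt0// exprn_gt0.
  have p0 : 0 <= 4 ^- n :> R by rewrite invr_ge0 exprn_ge0.
  have p1 : 4 ^- n <= 1 :> R by rewrite invf_le1 ?exprn_gt0// exprn_ege1//; lra.
  exists n; first exact: mem_box_dist.
  rewrite lee_fin indicE mem_set ?mulr1.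
    apply: kernel_le_near => //.
    by rewrite -[leRHS]invrK lef_pV2 ?posrE ?invr_gt0// ?exprn_gt0// ltW.
  by apply: (@layer_near x y) => //; [rewrite p0|exact: DS].
apply: lee_nneseries => n.
  by move=> _ _; rewrite mule_ge0// lee_fin mulr_ge0 ?exprn_ge0// indicE ler0n.
move=> _; rewrite [X in (_ * X)%E]leb2_boxE ?invr_ge0 ?exprn_ge0// -EFinM lee_fin.
rewrite le_eqVlt; apply/orP; left; apply/eqP.
have -> : 2 ^+ n = 32 ^+ n * (4 ^- n) ^+ 2 :> R.
  rewrite -[4 ^- n]exprVn -[(_ ^+ n) ^+ 2]exprM mulnC exprM -exprMn.
  by congr (_ ^+ _); field.
by rewrite [32 ^+ n.+1]exprS; ring.
Qed.

(** Integrated over the ball, the near field gives a series with terms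
    2 ^ n * |layer (4 ^ -n)| of order 2 ^ -n; the convergence relies on the
    exponent 2 + 2 s being less than 3. *)
Lemma interaction_lty s : 0 < s <= 1 / 4 ->
  (interaction s (@unit_ball R) (@Sigma R) < +oo)%E.
Proof.
move=> s4; have s0 : 0 < s by lra.
set F : R := 16 / (1 - 2 `^ (- (2 * s))).
pose G x : \bar R := (\sum_(0 <= n <oo) (128 * 2 ^+ n * \1_(layer (4 ^- n)) x)%:E)%E.
have g0 n x : (0 <= (128 * 2 ^+ n * \1_(layer (4 ^- n)) x)%:E :> \bar R)%E.
  by rewrite lee_fin !mulr_ge0 ?exprn_ge0// indicE ler0n.
have G0 x : (0 <= G x)%E by apply: nneseries_ge0 => n _ _; exact: g0.
have mB := @measurable_unit_ball R; have mS := @measurable_Sigma R.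
have mG : measurable_fun (@unit_ball R) G.
  apply: ge0_emeasurable_sum => // n _; apply/measurable_EFinP.
  by apply: measurable_funM => //; apply: measurable_indic; exact: measurable_layer.
have F0 : 0 <= F.
  rewrite -lee_fin.
  have := @far_integral_le s (0, 0) set0 s0 measurable0.
  by rewrite integral_set0; apply.
have Bfin := leb2_unit_ball_lty (@subset_refl _ (@unit_ball R)) mB.
apply: (@le_lt_trans _ _ (\int[leb2 R]_(x in @unit_ball R) (G x + cst F%:E x))%E).
  apply: ge0_le_integral.
  - exact: mB.
  - by move=> x _; exact: inner_integral_ge0.
  - exact: (measurable_funTS (@measurable_inner_integral R s _ mS)).
  - by apply: emeasurable_funD.
  move=> x xB; have md := measurable_eucl_dist_snd x.
  have m1 : measurable [set y | eucl_dist x y < 1] by exact: measurable_set_lt.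
  have m2 : measurable [set y | 1 <= eucl_dist x y] by exact: measurable_set_le.
  rewrite (_ : @Sigma R = (@Sigma R `&` [set y | eucl_dist x y < 1]) `|`
    (@Sigma R `&` [set y | 1 <= eucl_dist x y])); last first.
    rewrite -setIUr (_ : _ `|` _ = setT) ?setIT//; apply/seteqP; split => // y _ /=.
    by have [|] := ltP (eucl_dist x y) 1; [left|right].
  rewrite ge0_integral_setU; first last.
  - by apply/disj_setPS => y [[_ /= h1] [_ /= h2]]; move: h2; rewrite leNgt h1.
  - by move=> y _; rewrite lee_fin kernel_ge0.
  - by apply: measurable_funTS; exact: measurable_kernel_snd.
  - exact: measurableI.
  - exact: measurableI.
  apply: leeD.
  - apply: near_integral_le;
      [exact: s4|exact: xB|exact: measurableI|by move=> y []|by move=> y []].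
  - apply: far_integral_le; [exact: s0|exact: measurableI|by move=> y []].
rewrite ge0_integralD//.
apply: lte_add_pinfty; last first.
  by rewrite integral_cst// lte_mul_pinfty.
apply: le_lt_trans.
  apply: (@integral_indic_series_le _ _ _ (leb2 R) _ (fun n => layer (4 ^- n))
    (fun n => 128 * 2 ^+ n)) => //.
  by move=> n; exact: measurable_layer.
have := @epsilon_trick0 R (2 * (128 * 256)) xpredT.
have e0 : 0 <= 2 * (128 * 256) :> R by apply: mulr_ge0 => //; exact: mulr_ge0.
move=> /(_ e0) h; apply: le_lt_trans; last exact: (ltry (2 * (128 * 256))).
apply: le_trans h; apply: lee_nneseries => n.
  by move=> _ _; rewrite mule_ge0// lee_fin mulr_ge0// exprn_ge0.
move=> _; apply: (@le_trans _ _ ((128 * 2 ^+ n)%:E * (256 * 4 ^- n)%:E)%E).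
  apply: lee_wpmul2l; first by rewrite lee_fin mulr_ge0// exprn_ge0.
  by apply: leb2_layer; rewrite invr_ge0 exprn_ge0.
rewrite -EFinM lee_fin natrX exprS invfM le_eqVlt; apply/orP; left; apply/eqP.
rewrite (_ : 4 ^- n = 2 ^- n * 2 ^- n); last first.
  by rewrite -invfM -exprMn; congr (_ ^- _); ring.
have p0 : 2 ^+ n != 0 :> R by rewrite expf_neq0.
by field.
Qed.

End finiteness.

(** * Minimality and uniqueness *)

Section minimality.
Context (R : realType).
Implicit Types (x y : plane R) (s : R) (A E F G : set (plane R)).

Lemma ae_eq_set_integral F F' (f : plane R -> \bar R) :
  measurable F -> measurable F' -> measurable_fun setT f -> (forall x, 0 <= f x)%E ->
  ae_eq_set F F' ->
  (\int[leb2 R]_(x in F) f x = \int[leb2 R]_(x in F') f x)%E.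
Proof.
move=> mF mF' mf f0 FF'; rewrite (integral_mkcond F) (integral_mkcond F').
have mr (D : set (plane R)) : measurable D -> measurable_fun setT (f \_ D).
  by move=> mD; apply/(measurable_restrictT _ _).1 => //; exact: measurable_funTS.
apply: ge0_ae_eq_integral.
- exact: measurableT.
- exact: mr.
- exact: mr.
- by move=> x _; rewrite patchE; case: ifP.
- by move=> x _; rewrite patchE; case: ifP.
move: FF'; rewrite /ae_eq_set /ae_eq; apply: filterS => x FF' _; rewrite !patchE.
by congr (if _ then _ else _); apply/idP/idP; rewrite !inE => /FF'.
Qed.

Lemma interaction_ae_r s F G G' : measurable G -> measurable G' -> ae_eq_set G G' ->
  interaction s F G = interaction s F G'.
Proof.
move=> mG mG' GG'; apply: eq_integral => x _.
apply: ae_eq_set_integral => //; first exact: (measurable_kernel_snd s x).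
by move=> y; rewrite lee_fin; exact: (kernel_ge0 s x y).
Qed.

Lemma interaction_setU s F F' G : measurable F -> measurable F' -> measurable G ->
  [disjoint F & F'] ->
  (interaction s (F `|` F') G = interaction s F G + interaction s F' G)%E.
Proof.
move=> mF mF' mG FF'; apply: ge0_integral_setU => //.
- exact: (measurable_funTS (@measurable_inner_integral R s G mG)).
- by move=> x _; exact: inner_integral_ge0.
Qed.

Lemma admissible_Sigma : admissible (@unit_ball R) (@Sigma R) (@Sigma R).
Proof.
split; first exact: measurable_Sigma.
by apply: aeW => x; split => [[]//|Sx]; split=> //; exact: Sx.1.
Qed.

Lemma admissible_split F : admissible (@unit_ball R) (@Sigma R) F ->
  ae_eq_set F (@Sigma R `|` (F `&` @unit_ball R)).
Proof.
move=> [_]; rewrite /ae_eq_set; apply: filterS => x FS; split => [Fx|[/FS[]//|[]//]].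
by have [Bx|nBx] := pselect (unit_ball x); [right|left; apply/FS].
Qed.

Lemma Per_Sigma s : Per s (@Sigma R) (@unit_ball R) = interaction s (@unit_ball R) (@Sigma R).
Proof.
rewrite /Per (_ : _ `&` _ = set0); last first.
  by apply/seteqP; split => // x [[nB _] B]; exact: nB.
rewrite (_ : @unit_ball R `\` _ = @unit_ball R); last first.
  by apply/seteqP; split => [x []//|x Bx]; split => // -[].
rewrite (_ : @Sigma R `\` _ = @Sigma R); last first.
  by apply/seteqP; split => [x []//|x Sx]; split => //; exact: Sx.1.
by rewrite {1}/interaction integral_set0 add0e.
Qed.

Lemma Per_admissible s F : admissible (@unit_ball R) (@Sigma R) F ->
  Per s F (@unit_ball R) =
  (interaction s (F `&` @unit_ball R) (~` (@Sigma R `|` (F `&` @unit_ball R))) +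
   interaction s (@unit_ball R `\` (F `&` @unit_ball R)) (@Sigma R))%E.
Proof.
move=> aF; have [mF FS] := aF.
have mB := @measurable_unit_ball R; have mS := @measurable_Sigma R.
have mA : measurable (F `&` @unit_ball R) by exact: measurableI.
have mSA : measurable (@Sigma R `|` (F `&` @unit_ball R)) by exact: measurableU.
have e1 : interaction s (F `&` @unit_ball R) (~` F) =
    interaction s (F `&` @unit_ball R) (~` (@Sigma R `|` (F `&` @unit_ball R))).
  apply: interaction_ae_r; [exact: measurableC|exact: measurableC|].
  move: (admissible_split aF); rewrite /ae_eq_set.
  by apply: filterS => x FE; split => nF ?; apply: nF; apply/FE.
have e2 : interaction s (@unit_ball R `\` F) (F `\` @unit_ball R) =
    interaction s (@unit_ball R `\` (F `&` @unit_ball R)) (@Sigma R).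
  rewrite (_ : @unit_ball R `\` (F `&` _) = @unit_ball R `\` F).
    by apply: interaction_ae_r => //; exact: measurableD.
  by apply/seteqP; split => x [Bx nF]; split => // Fx; apply: nF; [split|case: Fx].
by rewrite /Per e1 e2.
Qed.

Lemma Per_ge_Sigma : exists so : R, 0 < so <= 1 / 4 /\
  forall s F, 0 < s <= so -> admissible (@unit_ball R) (@Sigma R) F ->
  (Per s (@Sigma R) (@unit_ball R) + leb2 R (F `&` @unit_ball R) <=
   Per s F (@unit_ball R))%E.
Proof.
have [so [so0 gap]] := energy_gap R.
exists so; split => // s F sso aF; have [mF _] := aF.
have mB := @measurable_unit_ball R; have mS := @measurable_Sigma R.
have mA : measurable (F `&` @unit_ball R) by exact: measurableI.
rewrite Per_Sigma (Per_admissible s aF).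
set A := F `&` _ in mA *.
rewrite (_ : interaction s (@unit_ball R) (@Sigma R) =
    interaction s A (@Sigma R) + interaction s (@unit_ball R `\` A) (@Sigma R))%E; last first.
  rewrite -interaction_setU//; last 2 first.
  - exact: measurableD.
  - by apply/disj_setPS => x [Ax [_]].
  by congr interaction; rewrite setDUK// => x [].
rewrite addeAC; apply: leeD => //; apply: gap => // x [] //.
Qed.

End minimality.

Unset Implicit Arguments.

Theorem theorem1p3 (R : realType) :
  exists so : R, (0 < so < 1 / 2) /\
    forall s : R, 0 < s <= so ->
      is_minimizer s (@unit_ball R) (@Sigma R) (@Sigma R) /\
      forall E : set (plane R),
        is_minimizer s (@unit_ball R) (@Sigma R) E -> ae_eq_set E (@Sigma R).
Proof.
have [so [so4 ge]] := Per_ge_Sigma R.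
exists so; split; first by case/andP: so4 => -> /=; lra.
move=> s sso; split.
  split; first exact: admissible_Sigma.
  move=> F aF; apply: le_trans (ge s F sso aF).
  by rewrite leeDl.
move=> E [aE minE].
have := le_trans (ge s E sso aE) (minE _ (admissible_Sigma R)).
have fin : Per s (@Sigma R) (@unit_ball R) \is a fin_num.
  rewrite Per_Sigma ge0_fin_numE; last first.
    by apply: integral_ge0 => x _; exact: inner_integral_ge0.
  by apply: interaction_lty; move: sso so4; lra.
rewrite -[leRHS]adde0 leeD2lE// => A0.
have mA : measurable (E `&` @unit_ball R).
  by apply: measurableI; [exact: aE.1|exact: measurable_unit_ball].
have null : {ae leb2 R, forall x, ~ (E `&` @unit_ball R) x}.
  exists (E `&` @unit_ball R); split => //; last by move=> x /= /contrapT.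
  by apply/eqP; rewrite eq_le A0 measure_ge0.
move: (admissible_split aE) null; rewrite /ae_eq_set; apply: filterS2 => x EA nA.
by split => [/EA[//|/nA[]]|Sx]; apply: EA.2; left.
Qed.
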